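(* Let $m>0$ be a real number and, for $\delta>0$, let $f_\delta(z)=e^{-\delta|z|^m}$, $z\in\mathbb C$. Then the following are equivalent: (1) $B_{\alpha,m}B_{\beta,m}f=B_{\beta,m}B_{\alpha,m}f$ for all $f\in L^\infty(\mathbb C)$ and all $\alpha,\beta>0$; (2) $B_{\alpha,m}B_{\beta,m}f_\delta=B_{\beta,m}B_{\alpha,m}f_\delta$ for all $\alpha,\beta,\delta>0$; (3) $(B_{\alpha,m}B_{\beta,m}f_\delta)(0)=(B_{\beta,m}B_{\alpha,m}f_\delta)(0)$ for all $\alpha,\beta,\delta>0$; (4) $m=2$.
   Context: For real $m>0$ and $\alpha>0$, let $d\mu_{\alpha,m}(z)=\frac{m\alpha^{2/m}}{2\pi\Gamma(2/m)}e^{-\alpha|z|^m}\,dA(z)$, where $dA$ is Lebesgue area measure on $\mathbb C$ (so $\mu_{\alpha,m}(\mathbb C)=1$). Let $F^2_{\alpha,m}$ be the Hilbert space of entire functions that are square integrable with respect to $\mu_{\alpha,m}$, and let $K_{\alpha,m}(\cdot,\cdot)$ be its reproducing kernel, i.e. $f(z)=\langle f,K_{\alpha,m}(\cdot,z)\rangle_{L^2(\mu_{\alpha,m})}$ for $f\in F^2_{\alpha,m}$. The Berezin transform of $f\in L^\infty(\mathbb C)$ is $(B_{\alpha,m}f)(z)=\int_{\mathbb C} f(w)\frac{|K_{\alpha,m}(w,z)|^2}{K_{\alpha,m}(z,z)}\,d\mu_{\alpha,m}(w)$, $z\in\mathbb C$; it maps $L^\infty(\mathbb C)$ into itself. *)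

(* Defs.v *)
(* MathComp + MathComp-Analysis; complex numbers R[i] from real_closed. *)
From HB Require Import structures.
From mathcomp Require Import all_boot all_order all_algebra.
From mathcomp Require Import all_classical all_reals all_analysis.
From mathcomp Require Import complex.
Set Implicit Arguments. Unset Strict Implicit. Unset Printing Implicit Defensive.
Import Order.TTheory GRing.Theory Num.Theory.
Import numFieldNormedType.Exports.
Local Open Scope classical_set_scope.
Local Open Scope ring_scope.

Section Fock.
Variable R : realType.

(* The complex plane as the measurable space R x R (z = x + i y),
   with area measure dA = Lebesgue (x) Lebesgue. *)
Definition pt := (R * R)%type.
Definition dA := ((@lebesgue_measure R) \x (@lebesgue_measure R))%E.

Definition toC (z : pt) : R[i] := (z.1 +i* z.2)%C.
(* |z| *)
Definition absz (z : pt) : R := Num.sqrt (z.1 ^+ 2 + z.2 ^+ 2).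

(* Euler Gamma function Gamma(s) = int_0^oo t^(s-1) e^(-t) dt *)
Definition Gamma (s : R) : R :=
  Rintegral (@lebesgue_measure R) `]0, +oo[%classic
    (fun t => powR t (s - 1) * expR (- t)).

(* density of mu_{alpha,m} w.r.t. dA *)
Definition dens (alpha m : R) (z : pt) : R :=
  m * powR alpha (2 / m) / (2 * pi * Gamma (2 / m)) * expR (- (alpha * powR (absz z) m)).

(* integral of a complex-valued function against mu_{alpha,m}
   (real and imaginary parts integrated separately) *)
Definition cint (alpha m : R) (g : pt -> R[i]) : R[i] :=
  (Rintegral dA setT (fun w => complex.Re (g w) * dens alpha m w)
   +i* Rintegral dA setT (fun w => complex.Im (g w) * dens alpha m w))%C.

(* entire functions: given by a power series converging on all of C *)
Definition entire (f : pt -> R[i]) : Prop :=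
  exists a : nat -> R[i], forall z : pt,
    ((fun N => complex.Re (\sum_(n < N) a n * toC z ^+ n)) @ \oo
        --> complex.Re (f z)) /\
    ((fun N => complex.Im (\sum_(n < N) a n * toC z ^+ n)) @ \oo
        --> complex.Im (f z)).

(* membership in F^2_{alpha,m} *)
Definition inF2 (alpha m : R) (f : pt -> R[i]) : Prop :=
  entire f /\
  (\int[dA]_w ((Normc.normc (f w)) ^+ 2 * dens alpha m w)%:E < +oo)%E.

(* K is the reproducing kernel of F^2_{alpha,m}:
   K(., z) in F^2 and f(z) = <f, K(., z)> for all f in F^2 *)
Definition reproducing_kernel (alpha m : R) (K : pt -> pt -> R[i]) : Prop :=
  forall z : pt, inF2 alpha m (fun w => K w z) /\
    forall f, inF2 alpha m f ->
      f z = cint alpha m (fun w => f w * (K w z)^*).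

(* Berezin transform *)
Definition berezin (alpha m : R) (K : pt -> pt -> R[i]) (f : pt -> R[i]) : pt -> R[i] :=
  fun z => cint alpha m (fun w => f w * ((Normc.normc (K w z)) ^+ 2)%:C%C / K z z).

(* (a representative of) an element of L^oo(C): measurable and bounded *)
Definition Linfty (f : pt -> R[i]) : Prop :=
  measurable_fun setT (fun w => complex.Re (f w)) /\
  measurable_fun setT (fun w => complex.Im (f w)) /\
  exists M : R, forall w, Normc.normc (f w) <= M.

(* f_delta(z) = exp(-delta |z|^m) *)
Definition fdelta (delta m : R) : pt -> R[i] :=
  fun z => (expR (- (delta * powR (absz z) m)))%:C%C.

End Fock.

(* Main.v *)
Require Import Defs.
From HB Require Import structures.
From mathcomp Require Import all_boot all_order all_algebra.
From mathcomp Require Import all_classical all_reals all_analysis measurable_realfun.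
From mathcomp Require Import complex ring lra.
Set Implicit Arguments.
Unset Strict Implicit.
Unset Printing Implicit Defensive.
Import Order.TTheory GRing.Theory Num.Theory.
Import numFieldNormedType.Exports.
(* Defs is imported again so that [absz] is the modulus of the plane and not
   the absolute value of [int]. *)
Import Defs.
Local Open Scope classical_set_scope.
Local Open Scope ring_scope.

(** Write s = 2/m, I_n for the integral of |w|^(2n) exp(-|w|^m) and
    E(x) = sum_n x^n / I_n. Rotation invariance of the area measure makes the
    monomials orthogonal, so the kernel is K_a(w, z) = E(a^s w z^* ) up to a
    constant; no value of Gamma is needed. The reproducing property then gives
    B_b f_d (z) = t E(t x) / E(x) with x = b^s |z|^2 and t = (b / (b + d))^s.

    (3) => (4): as d -> oo, commutation at the origin becomes the symmetry in
    (a, b) of the integral of exp(-a |z|^m) / E(b^s |z|^2). With a = eps -> 0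
    and b = 1, one side differs from its limit by a quantity of exact order eps,
    the other one by a quantity of exact order eps^s; hence s = 1.

    (4) => (1): for m = 2 the moments are I_n = n! I_0, so E is the exponential
    and B_a is the convolution with a Gaussian. *)

(** Every computation on the plane comes from an invariance of the area measure, so polar
    coordinates never enter: rotations give orthogonality, dilations give the dependence of the
    moments on the parameter, point reflections give the symmetry of a convolution. What the
    integrals alone do not show is read off from the existence of the kernels: reproducing the
    monomials forces the moments to be nonzero, and a kernel that is entire in w makes the series E
    converge everywhere. Limits are replaced by explicit inequalities at d = e^t and eps = e^-t,
    closed by one lemma on exponentially small bounds. In (3) => (4) exact orders are essential:
    upper bounds on the two differences only show that the two limits agree, and it is the strictly
    positive lower bounds that exclude s < 1 and s > 1. *)

Local Notation cRe := (@complex.Re _).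
Local Notation cIm := (@complex.Im _).
Local Notation normc := Normc.normc.

(** * Area measure under affine maps *)

Section affine.
Variable R : realType.
Local Notation leb := (@lebesgue_measure R).
Local Open Scope ereal_scope.

Lemma measurable_affine (a b : R) :
  measurable_fun [set: measurableTypeR R]
    (fun x : R => (a * x + b)%R : measurableTypeR R).
Proof. exact: measurable_funD. Qed.

(** The image of Lebesgue measure under x -> a x + b, multiplied by a, gives every half-open
    interval its length, so it is Lebesgue measure by uniqueness. *)
Lemma ge0_integral_affine_pos (a b : R) (f : R -> \bar R) : (0 < a)%R ->
  measurable_fun setT f -> (forall x, 0 <= f x) ->
  \int[leb]_x f x = a%:E * \int[leb]_x f (a * x + b)%R.
Proof.
move=> a0 mf f0.
have aa : (0 <= a)%R by apply: ltW.
pose phi := fun x : R => (a * x + b)%R : measurableTypeR R.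
pose mu0 := mscale (NngNum aa) (pushforward leb phi).
pose mu := mu0 (measurable_affine a b).
have -> : \int[leb]_x f x = \int[mu]_x f x.
  apply: eq_measure_integral => A mA _.
  apply: lebesgue_measure_unique => // _ [[u v]] _ <- /=.
  rewrite /mu /mu0 /mscale /= /pushforward.
  have -> : phi @^-1` `]u, v] = `]((u - b) / a)%R, ((v - b) / a)%R]%classic.
    apply/seteqP; split => x /=; rewrite !in_itv /= /phi.
      by rewrite ltr_pdivrMr // ler_pdivlMr // ltrBlDr lerBrDr mulrC.
    by rewrite ltr_pdivrMr // ler_pdivlMr // ltrBlDr lerBrDr mulrC.
  rewrite /= !lebesgue_measure_itv /= !lte_fin ltr_pM2r ?invr_gt0 // ltrD2r.
  case: ifPn => // _; last by rewrite mule0.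
  by rewrite -!EFinD -EFinM; congr EFin; field; rewrite gt_eqF.
rewrite ge0_integral_mscale //=; congr (_ * _).
by rewrite ge0_integral_pushforward //; exact: measurable_affine.
Qed.

Lemma ge0_integral_shift (b : R) (f : R -> \bar R) :
  measurable_fun setT f -> (forall x, 0 <= f x) ->
  \int[leb]_x f (x + b)%R = \int[leb]_x f x.
Proof.
move=> mf f0; rewrite [RHS](ge0_integral_affine_pos b ltr01 mf f0) mul1e.
by under [RHS]eq_integral do rewrite mul1r.
Qed.

Lemma ge0_integral_reflect (b : R) (f : R -> \bar R) :
  measurable_fun setT f -> (forall x, 0 <= f x) ->
  \int[leb]_x f (b - x)%R = \int[leb]_x f x.
Proof.
move=> mf f0.
rewrite -(@ge0_integral_shift b f) //.
pose g x := f (x + b)%R.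
have mg : measurable_fun setT g.
  by apply: (measurableT_comp mf); exact: measurable_funD.
have g0 x : 0 <= g x by exact: f0.
transitivity (\int[leb]_x (g \o -%R) x).
  by apply: eq_integral => x _; rewrite /g /= addrC.
transitivity (\int[pushforward leb (-%R : R -> measurableTypeR R)]_x g x).
  by rewrite ge0_integral_pushforward.
by apply: eq_measure_integral => A mA _; exact: lebesgue_measureN.
Qed.

End affine.

Section plane.
Variable R : realType.
Local Notation leb := (@lebesgue_measure R).
Local Notation dA := (@dA R).
Local Open Scope ereal_scope.
Implicit Types f : pt R -> \bar R.

Lemma dA_iter1 f : measurable_fun setT f -> (forall z, 0 <= f z) ->
  \int[dA]_z f z = \int[leb]_x \int[leb]_y f (x, y).
Proof. by move=> mf f0; rewrite /Defs.dA fubini_tonelli1. Qed.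

Lemma dA_iter2 f : measurable_fun setT f -> (forall z, 0 <= f z) ->
  \int[dA]_z f z = \int[leb]_y \int[leb]_x f (x, y).
Proof. by move=> mf f0; rewrite /Defs.dA fubini_tonelli2. Qed.

Lemma measurable_slice1 f (x : R) : measurable_fun setT f ->
  measurable_fun setT (fun y => f (x, y)).
Proof. by move=> mf; exact: measurable_fun_pair2. Qed.

Lemma measurable_slice2 f (y : R) : measurable_fun setT f ->
  measurable_fun setT (fun x => f (x, y)).
Proof. by move=> mf; exact: measurable_fun_pair1. Qed.

Lemma ge0_dA_reflect f (c : pt R) : measurable_fun setT f -> (forall z, 0 <= f z) ->
  \int[dA]_z f (c.1 - z.1, c.2 - z.2)%R = \int[dA]_z f z.
Proof.
move=> mf f0.
rewrite dA_iter1//; last first.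
  apply: (measurableT_comp mf); apply/measurable_fun_pair => /=; exact: measurable_funB.
rewrite (dA_iter1 mf f0) /=.
transitivity (\int[leb]_x \int[leb]_y f ((c.1 - x)%R, y)).
  apply: eq_integral => x _.
  by rewrite (ge0_integral_reflect c.2 (measurable_slice1 (c.1 - x)%R mf)).
rewrite (@ge0_integral_reflect R c.1 (fun x => \int[leb]_y f (x, y))) //.
  exact: measurable_fun_fubini_tonelli_F.
by move=> x; apply: integral_ge0.
Qed.

Lemma ge0_dA_shear1 f (p : R) : measurable_fun setT f -> (forall z, 0 <= f z) ->
  \int[dA]_z f (z.1 + p * z.2, z.2)%R = \int[dA]_z f z.
Proof.
move=> mf f0; rewrite dA_iter2//; last first.
  apply: (measurableT_comp mf); apply/measurable_fun_pair => //=.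
  by apply: measurable_funD => //; apply: measurable_funM.
rewrite (dA_iter2 mf f0) /=; apply: eq_integral => y _.
by rewrite (ge0_integral_shift (p * y)%R (measurable_slice2 y mf)).
Qed.

Lemma ge0_dA_shear2 f (p : R) : measurable_fun setT f -> (forall z, 0 <= f z) ->
  \int[dA]_z f (z.1, z.2 + p * z.1)%R = \int[dA]_z f z.
Proof.
move=> mf f0; rewrite dA_iter1//; last first.
  apply: (measurableT_comp mf); apply/measurable_fun_pair => //=.
  by apply: measurable_funD => //; apply: measurable_funM.
rewrite (dA_iter1 mf f0) /=; apply: eq_integral => x _.
by rewrite (ge0_integral_shift (p * x)%R (measurable_slice1 x mf)).
Qed.

Lemma ge0_dA_scale f (r : R) : (0 < r)%R ->
  measurable_fun setT f -> (forall z, 0 <= f z) ->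
  \int[dA]_z f z = (r ^+ 2)%:E * \int[dA]_z f (r * z.1, r * z.2)%R.
Proof.
move=> r0 mf f0.
have mfr : measurable_fun setT (fun z : pt R => f (r * z.1, r * z.2)%R).
  by apply: (measurableT_comp mf); apply/measurable_fun_pair => //=; exact: measurable_funM.
rewrite !dA_iter1//=.
have mF : measurable_fun setT (fun x => \int[leb]_y f (x, y)).
  exact: measurable_fun_fubini_tonelli_F.
have F0 x : 0 <= \int[leb]_y f (x, y) by exact: integral_ge0.
rewrite (ge0_integral_affine_pos 0 r0 mF F0).
rewrite expr2 EFinM -muleA; congr (_ * _).
rewrite -ge0_integralZl//; first last.
- by rewrite lee_fin ltW.
- by move=> x _; exact: integral_ge0.
- by apply: (@measurable_fun_fubini_tonelli_F _ _ _ _ _ leb (fun z => f (r * z.1, r * z.2)%R)).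
apply: eq_integral => x _; rewrite addr0 /fubini_F.
rewrite (ge0_integral_affine_pos 0 r0 (measurable_slice1 (r * x)%R mf)) //.
by under eq_integral do rewrite addr0.
Qed.

Lemma measurable_rot (a b : R) :
  measurable_fun setT (fun z : pt R => (a * z.1 - b * z.2, b * z.1 + a * z.2)%R : pt R).
Proof.
by apply/measurable_fun_pair => /=;
  [apply: measurable_funB|apply: measurable_funD]; exact: measurable_funM.
Qed.

(* A rotation by an angle that is not a multiple of pi is a product of three
   shears. *)
Lemma ge0_dA_rot f (a b : R) : (a ^+ 2 + b ^+ 2 = 1)%R ->
  measurable_fun setT f -> (forall z, 0 <= f z) ->
  \int[dA]_z f (a * z.1 - b * z.2, b * z.1 + a * z.2)%R = \int[dA]_z f z.
Proof.
move=> ab mf f0.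
have [b0|b0] := eqVneq b 0%R.
  move: ab; rewrite b0 expr0n addr0 => /eqP.
  rewrite sqrf_eq1 => /orP[] /eqP ->.
    by apply: eq_integral => -[x y] _ /=; rewrite !mul1r !mul0r subr0 add0r.
  rewrite -[RHS](ge0_dA_reflect (0, 0)%R mf f0).
  by apply: eq_integral => -[x y] _ /=; rewrite !mulN1r !mul0r subr0 !add0r.
(* For the angle theta with a = cos theta and b = sin theta this is - tan (theta / 2), the
   coefficient of the two outer shears; the middle one has coefficient b. *)
pose p := ((a - 1) / b)%R.
have shm1 : measurable_fun setT (fun z : pt R => (z.1 + p * z.2, z.2)%R : pt R).
  by apply/measurable_fun_pair => //=; apply: measurable_funD => //; exact: measurable_funM.
have shm2 : measurable_fun setT (fun z : pt R => (z.1, z.2 + b * z.1)%R : pt R).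
  by apply/measurable_fun_pair => //=; apply: measurable_funD => //; exact: measurable_funM.
rewrite -(ge0_dA_shear1 p mf f0).
rewrite -(@ge0_dA_shear2 (fun z => f (z.1 + p * z.2, z.2)%R) b)//=; last exact: measurableT_comp mf _.
rewrite -(@ge0_dA_shear1 (fun z => f (z.1 + p * (z.2 + b * z.1), z.2 + b * z.1)%R) p)//=; last first.
  by apply: (measurableT_comp (measurableT_comp mf shm1) shm2).
apply: eq_integral => -[x y] _ /=; congr (f (_, _)); rewrite /p; first last.
  by field.
have e1 : (p * b = a - 1)%R by rewrite /p; field.
have e2 : (p * (a + 1) = - b)%R.
  have -> : (p * (a + 1) = (a ^+ 2 - (a ^+ 2 + b ^+ 2)) / b)%R.
    by rewrite ab /p; field.
  by field.
rewrite -/p [RHS](_ : _ = (1 + p * b) * x + (p * (p * b + 2)) * y)%R; last by ring.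
rewrite e1 (_ : a - 1 + 2 = a + 1)%R; last by ring.
by rewrite e2; ring.
Qed.

End plane.

(** * Integrability on the plane *)

Section integrability.
Variable R : realType.
Local Notation leb := (@lebesgue_measure R).
Local Notation dA := (@dA R).
Local Notation integ f := (dA.-integrable setT (EFin \o f)).

(** Tonelli gives invariance for nonnegative functions; positive and negative parts carry it over to
    any measurable function, integrable or not. *)
Lemma dA_preserving (phi : pt R -> pt R) (f : pt R -> \bar R) :
  measurable_fun setT phi -> measurable_fun setT f ->
  (forall g : pt R -> \bar R, measurable_fun setT g -> (forall z, (0 <= g z)%E) ->
     (\int[dA]_z g (phi z) = \int[dA]_z g z)%E) ->
  (\int[dA]_z f (phi z) = \int[dA]_z f z)%E.
Proof.
move=> mphi mf H; rewrite integralE [RHS]integralE.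
congr (_ - _)%E.
  rewrite -(H f^\+%E) //; last exact: measurable_funepos.
  by apply: eq_integral => z _; rewrite !funeposE.
rewrite -(H f^\-%E) //; last exact: measurable_funeneg.
by apply: eq_integral => z _; rewrite !funenegE.
Qed.

Lemma integrable_oneDsqrV : leb.-integrable setT (fun x => ((1 + x ^+ 2)^-1)%:E).
Proof.
have mf : measurable_fun setT (fun x : R => (1 + x ^+ 2)^-1).
  by apply: continuous_measurable_fun; exact: continuous_oneDsqrV.
apply/integrableP; split; first exact/measurable_EFinP.
have p0 (x : R) : 0 <= (1 + x ^+ 2)^-1 by rewrite invr_ge0 addr_ge0 // sqr_ge0.
under eq_integral do rewrite /= ger0_norm //.
rewrite (@ge0_symfun_integralT R (fun x => (1 + x ^+ 2)^-1)) //.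
- have -> : [set x : R | 0 <= x] = `[0, +oo[%classic.
    by apply/seteqP; split => x /=; rewrite in_itv /= andbT.
  by have := @integral0y_oneDsqr R; rewrite /oneDsqr => ->; rewrite -EFinM ltry.
- exact: continuous_oneDsqrV.
- by move=> x /=; rewrite sqrrN.
Qed.

Lemma measurable_absz : measurable_fun setT (@absz R).
Proof.
apply: measurableT_comp => //=.
  by apply: continuous_measurable_fun; exact: sqrt_continuous.
by apply: measurable_funD; exact: measurable_funX.
Qed.

Lemma measurable_powR_absz (m : R) : measurable_fun setT (fun z : pt R => powR (absz z) m).
Proof. by apply: (measurableT_comp (measurable_powR m)); exact: measurable_absz. Qed.

(** An integrable majorant in product form: Tonelli splits its integral into two arctangent
    integrals. *)
Definition cauchy2 (z : pt R) : R := (1 + z.1 ^+ 2)^-1 * (1 + z.2 ^+ 2)^-1.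

Lemma integrable_cauchy2 : integ cauchy2.
Proof.
have mf1 : measurable_fun setT (fun x : R => (1 + x ^+ 2)^-1).
  by apply: continuous_measurable_fun; exact: continuous_oneDsqrV.
have mf : measurable_fun setT cauchy2.
  apply: measurable_funM.
    exact: (measurableT_comp mf1 measurable_fst).
  exact: (measurableT_comp mf1 measurable_snd).
have p0 (x : R) : 0 <= (1 + x ^+ 2)^-1 by rewrite invr_ge0 addr_ge0 // sqr_ge0.
have c0 z : 0 <= cauchy2 z by rewrite mulr_ge0.
apply/integrableP; split; first exact/measurable_EFinP.
under eq_integral do rewrite /= ger0_norm //.
rewrite dA_iter1; [|exact/measurable_EFinP|by move=> z; rewrite lee_fin].
have [_ i1] := integrableP _ _ _ integrable_oneDsqrV.
have fI : (\int[leb]_y ((1 + y ^+ 2)^-1)%:E)%E \is a fin_num.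
  by have /integrable_fin_num := integrable_oneDsqrV; apply.
have -> : (\int[leb]_x \int[leb]_y (cauchy2 (x, y))%:E =
    \int[leb]_x (((1 + x ^+ 2)^-1)%:E * \int[leb]_y ((1 + y ^+ 2)^-1)%:E))%E.
  apply: eq_integral => x _; rewrite /cauchy2 /=.
  under eq_integral do rewrite EFinM.
  rewrite ge0_integralZl //; first exact/measurable_EFinP.
    by move=> y _; rewrite lee_fin.
  by rewrite lee_fin.
rewrite -(fineK fI) ge0_integralZr//.
- rewrite -(fineK fI) -EFinM ltry //.
- exact/measurable_EFinP.
- by move=> y _; rewrite lee_fin.
- by rewrite fineK // integral_ge0 // => y _; rewrite lee_fin.
Qed.

Lemma absz_ge0 (z : pt R) : 0 <= absz z. Proof. exact: sqrtr_ge0. Qed.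

Lemma absz_sqr (z : pt R) : absz z ^+ 2 = z.1 ^+ 2 + z.2 ^+ 2.
Proof. by rewrite sqr_sqrtr // addr_ge0 // sqr_ge0. Qed.

Lemma integ_le (f g : pt R -> R) : measurable_fun setT f -> integ g ->
  (forall z, `|f z| <= g z) -> integ f.
Proof.
move=> mf ig fg; apply: le_integrable ig => //; first exact/measurable_EFinP.
by move=> z _; rewrite /= lee_fin (le_trans (fg z)) // ler_norm.
Qed.

Lemma integZ (c : R) (f : pt R -> R) : integ f -> integ (fun z => c * f z).
Proof. by move=> /(integrableZl measurableT c); apply: eq_integrable. Qed.

Lemma integD (f g : pt R -> R) : integ f -> integ g -> integ (fun z => f z + g z).
Proof. by move=> fi gi; apply: eq_integrable (integrableD _ fi gi). Qed.

Lemma integB (f g : pt R -> R) : integ f -> integ g -> integ (fun z => f z - g z).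
Proof. by move=> fi gi; apply: eq_integrable (integrableB _ fi gi). Qed.

Definition rapid (f : pt R -> R) :=
  forall n, exists C, forall z, absz z ^+ n * `|f z| <= C.

Lemma rapid_integ (f : pt R -> R) : measurable_fun setT f -> rapid f -> integ f.
Proof.
(* (1 + x^2)(1 + y^2) <= (1 + |z|^2)^2 = 1 + 2 |z|^2 + |z|^4, hence the orders 0, 2, 4 and the
   constant C0 + 2 C2 + C4. *)
move=> mf rf; have [C0 h0] := rf 0%N; have [C2 h2] := rf 2; have [C4 h4] := rf 4.
apply: (@integ_le _ (fun z => (C0 + 2 * C2 + C4) * cauchy2 z)) => //.
  exact: integZ integrable_cauchy2.
move=> z; rewrite /cauchy2 -invfM ler_pdivlMr; last first.
  by rewrite mulr_gt0 // ltr_pwDl // sqr_ge0.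
have := h0 z; have := h2 z; have := h4 z.
have -> : absz z ^+ 4 = (absz z ^+ 2) ^+ 2 by rewrite -exprM.
rewrite absz_sqr expr0 mul1r => k4 k2 k0.
have n0 : 0 <= `|f z| by [].
have x0 := sqr_ge0 z.1; have y0 := sqr_ge0 z.2.
have : `|f z| * ((1 + z.1 ^+ 2) * (1 + z.2 ^+ 2)) <=
  `|f z| * (1 + 2 * (z.1 ^+ 2 + z.2 ^+ 2) + (z.1 ^+ 2 + z.2 ^+ 2) ^+ 2).
  apply: ler_wpM2l => //; nra.
move=> /le_trans; apply; nra.
Qed.

Lemma rapidX (f : pt R -> R) k : rapid f -> rapid (fun z => absz z ^+ k * f z).
Proof.
move=> rf n; have [C h] := rf (n + k)%N; exists C => z.
by rewrite normrM ger0_norm ?exprn_ge0 ?absz_ge0 // mulrA -exprD.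
Qed.

Lemma rapid_exp (a m : R) : 0 < a -> 0 < m ->
  rapid (fun z : pt R => expR (- (a * powR (absz z) m))).
Proof.
move=> a0 m0 n.
(* N is such that n <= m (N + 1). For |z| > 1 this gives |z|^n <= (|z|^m)^(N + 1), and exp y >= y^(N
   + 1) / (N + 1)! absorbs this power; for |z| <= 1 the product is at most 1. *)
pose N := (Num.truncn (n%:R / m)).
have hN : n%:R <= m * N.+1%:R.
  by rewrite mulrC -ler_pdivrMr // ltW // truncnS_gt.
exists (1 + (N.+1)`!%:R / a ^+ N.+1) => z.
rewrite ger0_norm ?expR_ge0 //; have r0 := absz_ge0 z.
move: (absz z) r0 => r r0.
have C0 : 0 <= (N.+1)`!%:R / a ^+ N.+1 by rewrite divr_ge0 // exprn_ge0 // ltW.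
have [r1|r1] := leP r 1.
  apply: (@le_trans _ _ 1); last by rewrite lerDl.
  rewrite mulr_ile1 ?exprn_ge0 ?expR_ge0 ?exprn_ile1 // -expR0 ler_expR oppr_le0.
  by rewrite mulr_ge0 ?powR_ge0 // ltW.
apply: (@le_trans _ _ ((N.+1)`!%:R / a ^+ N.+1)); last by rewrite lerDr.
rewrite expRN ler_pdivrMr ?expR_gt0 //.
have y0 : 0 <= a * powR r m by rewrite mulr_ge0 ?powR_ge0 // ltW.
have := expR_ge1Dxn N y0.
move=> h; have {}h : (a * r `^ m) ^+ N.+1 / (N.+1)`!%:R <= expR (a * r `^ m).
  by apply: le_trans h; rewrite lerDr.
apply: le_trans (ler_wpM2l C0 h).
rewrite exprMn.
have -> : (N.+1)`!%:R / a ^+ N.+1 * (a ^+ N.+1 * r `^ m ^+ N.+1 / (N.+1)`!%:R) = r `^ m ^+ N.+1.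
  field; rewrite expf_neq0 ?gt_eqF //= pnatr_eq0 -lt0n fact_gt0 //.
rewrite -powR_mulrn // -powR_mulrn ?powR_ge0 // -powRrM ler_powR // ltW //.
Qed.

End integrability.

(** * Complex-valued integrals *)

Section complex_facts.
Variable R : realType.
Implicit Types x y : R[i].

Lemma cReD x y : cRe (x + y) = cRe x + cRe y. Proof. by case: x y => ? ? []. Qed.
Lemma cImD x y : cIm (x + y) = cIm x + cIm y. Proof. by case: x y => ? ? []. Qed.
Lemma cReN x : cRe (- x) = - cRe x. Proof. by case: x. Qed.
Lemma cReM x y : cRe (x * y) = cRe x * cRe y - cIm x * cIm y.
Proof. by case: x y => ? ? []. Qed.
Lemma cImM x y : cIm (x * y) = cRe x * cIm y + cIm x * cRe y.
Proof. by case: x y => ? ? []. Qed.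
Lemma cReJ x : cRe (conjc x) = cRe x. Proof. by case: x. Qed.
Lemma cImJ x : cIm (conjc x) = - cIm x. Proof. by case: x. Qed.
Lemma conj_conjc x : (x^*)%R = conjc x. Proof. by []. Qed.
Lemma complex_ext x y : cRe x = cRe y -> cIm x = cIm y -> x = y.
Proof. by case: x y => a b [c d] /= -> ->. Qed.
Lemma cReMr x (r : R) : cRe (x * r%:C%C) = cRe x * r.
Proof. by rewrite cReM /= mulr0 subr0. Qed.
Lemma cImMr x (r : R) : cIm (x * r%:C%C) = cIm x * r.
Proof. by rewrite cImM /= mulr0 add0r. Qed.

Lemma normc_ge0 x : 0 <= normc x. Proof. by case: x => a b; exact: sqrtr_ge0. Qed.
Lemma normc_sqr x : normc x ^+ 2 = cRe x ^+ 2 + cIm x ^+ 2.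
Proof. by case: x => a b /=; rewrite sqr_sqrtr // addr_ge0 // sqr_ge0. Qed.
Lemma mulcJ x : x * conjc x = (normc x ^+ 2)%:C%C.
Proof. by rewrite normc_sqr; case: x => a b; apply: complex_ext => /=; ring. Qed.
Lemma normc_conjc x : normc (conjc x) = normc x.
Proof. by case: x => a b /=; rewrite sqrrN. Qed.
Lemma normcX x n : normc (x ^+ n) = normc x ^+ n.
Proof. by elim: n => [|n IH]; rewrite ?expr0 ?Normc.normc1 // !exprS Normc.normcM IH. Qed.
Lemma normc_real (r : R) : normc r%:C%C = `|r|.
Proof. by rewrite /= expr0n addr0 sqrtr_sqr. Qed.
Lemma cRe_le_normc x : `|cRe x| <= normc x.
Proof.
rewrite -ler_sqr ?nnegrE ?normc_ge0 // real_normK ?num_real //.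
by rewrite normc_sqr lerDl sqr_ge0.
Qed.
Lemma cIm_le_normc x : `|cIm x| <= normc x.
Proof.
rewrite -ler_sqr ?nnegrE ?normc_ge0 // real_normK ?num_real //.
by rewrite normc_sqr lerDr sqr_ge0.
Qed.
Lemma normc_le x : normc x <= `|cRe x| + `|cIm x|.
Proof.
rewrite -ler_sqr ?nnegrE ?normc_ge0 ?addr_ge0 // normc_sqr sqrrD !real_normK ?num_real //.
by rewrite lerD2r lerDl mulrn_wge0 // mulr_ge0.
Qed.
Lemma normc_sum I (r : seq I) (F : I -> R[i]) :
  normc (\sum_(i <- r) F i) <= \sum_(i <- r) normc (F i).
Proof.
elim/big_ind2: _ => [|x a y b ha hb|//]; first by rewrite Normc.normc0.
by apply: le_trans (le_normcD _ _) _; exact: lerD.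
Qed.

Lemma toC_normc (z : pt R) : normc (toC z) = absz z. Proof. by []. Qed.

(** On the unit circle the product is zt^(j - k), so a root of -1 of order |j - k|, conjugated when
    j < k, does it. *)
Lemma exists_unit_root_m1 j k : j != k ->
  exists2 zt : R[i], normc zt = 1 & zt ^+ j * conjc zt ^+ k = -1.
Proof.
have aux l : (0 < l)%N -> exists2 zt : R[i], normc zt = 1 & zt ^+ l = -1.
  move=> l0; have e := rootCK l0 (-1 : R[i]); exists (l.-root (-1 : R[i])) => //.
  have : normc (l.-root (-1 : R[i])) ^+ l = 1.
    by rewrite -normcX e normcN Normc.normc1.
  by move=> /eqP; rewrite -[X in _ == X](expr1n _ l) eqrXn2 ?normc_ge0 // => /eqP.
have unit (zt : R[i]) n : normc zt = 1 -> zt ^+ n * conjc zt ^+ n = 1.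
  by move=> h; rewrite -exprMn mulcJ h expr1n expr1n.
rewrite neq_ltn => /orP[] jk.
  have kj0 : (0 < k - j)%N by rewrite subn_gt0.
  have [zt o1 oe] := aux _ kj0.
  exists (conjc zt); first by rewrite normc_conjc.
  rewrite conjcK -(subnKC (ltnW jk)) exprD mulrA [_ * zt ^+ j]mulrC.
  by rewrite unit // mul1r oe.
have jk0 : (0 < j - k)%N by rewrite subn_gt0.
have [zt o1 oe] := aux _ jk0.
exists zt => //.
by rewrite -(subnKC (ltnW jk)) exprD mulrAC unit // mul1r oe.
Qed.

End complex_facts.

Section complex_integral.
Variable R : realType.
Local Notation dA := (@dA R).
Local Notation integ f := (dA.-integrable setT (EFin \o f)).
Implicit Types g f : pt R -> R[i].

Definition dint (f : pt R -> R) : R := Rintegral dA setT f.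

Lemma dintZ (c : R) (f : pt R -> R) : integ f -> dint (fun z => c * f z) = c * dint f.
Proof. by move=> fi; exact: RintegralZl. Qed.

Lemma dintD (f g : pt R -> R) : integ f -> integ g ->
  dint (fun z => f z + g z) = dint f + dint g.
Proof. by move=> fi gi; exact: RintegralD. Qed.

Lemma dintB (f g : pt R -> R) : integ f -> integ g ->
  dint (fun z => f z - g z) = dint f - dint g.
Proof. by move=> fi gi; exact: RintegralB. Qed.

Lemma dint_le (f g : pt R -> R) : integ f -> integ g -> (forall z, f z <= g z) ->
  dint f <= dint g.
Proof. by move=> fi gi fg; apply: le_Rintegral => // z _. Qed.

Lemma eq_dint (f g : pt R -> R) : f =1 g -> dint f = dint g.
Proof. by move=> /funext ->. Qed.

Definition cmeas g := measurable_fun setT (fun z => cRe (g z)) /\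
  measurable_fun setT (fun z => cIm (g z)).
Definition cinteg g := integ (fun z => cRe (g z)) /\ integ (fun z => cIm (g z)).
Definition CI g : R[i] := (dint (fun z => cRe (g z)) +i* dint (fun z => cIm (g z)))%C.

Lemma cintE a m g : cint a m g = CI (fun w => g w * (dens a m w)%:C%C).
Proof. by congr Complex; apply: eq_Rintegral => z _; rewrite ?cReMr ?cImMr. Qed.

Lemma cmeasM f g : cmeas f -> cmeas g -> cmeas (fun z => f z * g z).
Proof.
move=> [f1 f2] [g1 g2]; split.
  rewrite (_ : (fun z => _) = fun z => cRe (f z) * cRe (g z) - cIm (f z) * cIm (g z)).
    by apply: measurable_funB; exact: measurable_funM.
  by apply/funext => z; rewrite cReM.
rewrite (_ : (fun z => _) = fun z => cRe (f z) * cIm (g z) + cIm (f z) * cRe (g z)).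
  by apply: measurable_funD; exact: measurable_funM.
by apply/funext => z; rewrite cImM.
Qed.

Lemma cmeasD f g : cmeas f -> cmeas g -> cmeas (fun z => f z + g z).
Proof.
move=> [f1 f2] [g1 g2]; split.
  rewrite (_ : (fun z => _) = fun z => cRe (f z) + cRe (g z)).
    exact: measurable_funD.
  by apply/funext => z; rewrite cReD.
rewrite (_ : (fun z => _) = fun z => cIm (f z) + cIm (g z)).
  exact: measurable_funD.
by apply/funext => z; rewrite cImD.
Qed.

Lemma cmeasJ f : cmeas f -> cmeas (fun z => conjc (f z)).
Proof.
move=> [f1 f2]; split.
  by rewrite (_ : (fun z => _) = fun z => cRe (f z)) //; apply/funext => z; rewrite cReJ.
rewrite (_ : (fun z => _) = fun z => - cIm (f z)); first exact: measurable_funN.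
by apply/funext => z; rewrite cImJ.
Qed.

Lemma cmeas_cst c : cmeas (fun=> c). Proof. by split; exact: measurable_cst. Qed.

Lemma cmeas_real (h : pt R -> R) : measurable_fun setT h -> cmeas (fun z => (h z)%:C%C).
Proof. by move=> mh; split => //=; exact: measurable_cst. Qed.

Lemma cmeas_toC : cmeas (@toC R).
Proof. by split; [exact: measurable_fst|exact: measurable_snd]. Qed.

Lemma cmeasX f n : cmeas f -> cmeas (fun z => f z ^+ n).
Proof.
move=> mf; elim: n => [|n IH].
  by rewrite (_ : (fun z => _) = fun=> 1) //; exact: cmeas_cst.
rewrite (_ : (fun z => _) = fun z => f z * f z ^+ n); first exact: cmeasM.
by apply/funext => z; rewrite exprS.
Qed.

Lemma cmeas_sum n (F : 'I_n -> pt R -> R[i]) : (forall i, cmeas (F i)) ->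
  cmeas (fun z => \sum_(i < n) F i z).
Proof.
elim: n F => [|n IH] F mF.
  rewrite (_ : (fun z => _) = fun=> 0); first exact: cmeas_cst.
  by apply/funext => z; rewrite big_ord0.
rewrite (_ : (fun z => _) = fun z =>
   \sum_(i < n) F (widen_ord (leqnSn n) i) z + F ord_max z).
  by apply: cmeasD => //; exact: IH.
by apply/funext => z; rewrite big_ord_recr.
Qed.

Lemma measurable_normc f : cmeas f -> measurable_fun setT (fun z => normc (f z)).
Proof.
move=> [f1 f2]; rewrite (_ : (fun z => _) =
  fun z => Num.sqrt (cRe (f z) ^+ 2 + cIm (f z) ^+ 2)).
  apply: (measurableT_comp (f := @Num.sqrt R)).
    by apply: continuous_measurable_fun; exact: sqrt_continuous.
  by apply: measurable_funD; exact: measurable_funX.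
by apply/funext => z; case: (f z).
Qed.

Lemma cinteg_le f (G : pt R -> R) : cmeas f -> integ G ->
  (forall z, normc (f z) <= G z) -> cinteg f.
Proof.
move=> [f1 f2] iG fG; split; apply: (integ_le _ iG) => // z.
  exact: le_trans (cRe_le_normc _) (fG z).
exact: le_trans (cIm_le_normc _) (fG z).
Qed.

Lemma CI_Zl c f : cinteg f -> CI (fun z => c * f z) = c * CI f.
Proof.
move=> [i1 i2]; apply: complex_ext; rewrite /= ?cReM ?cImM /dint.
  under eq_Rintegral do rewrite cReM.
  by rewrite RintegralB ?RintegralZl //; exact: integZ.
under eq_Rintegral do rewrite cImM.
by rewrite RintegralD ?RintegralZl //; exact: integZ.
Qed.

Lemma CI_D f g : cinteg f -> cinteg g -> CI (fun z => f z + g z) = CI f + CI g.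
Proof.
move=> [i1 i2] [j1 j2]; apply: complex_ext; rewrite ?cReD ?cImD /= /dint.
  by under eq_Rintegral do rewrite cReD; rewrite RintegralD.
by under eq_Rintegral do rewrite cImD; rewrite RintegralD.
Qed.

Lemma cintegD f g : cinteg f -> cinteg g -> cinteg (fun z => f z + g z).
Proof.
move=> [i1 i2] [j1 j2]; split.
  by apply: eq_integrable (integD i1 j1) => // z _; rewrite /= cReD.
by apply: eq_integrable (integD i2 j2) => // z _; rewrite /= cImD.
Qed.

Lemma eq_CI f g : f =1 g -> CI f = CI g.
Proof. by move=> /funext ->. Qed.

Lemma CI_sum n (F : 'I_n -> pt R -> R[i]) : (forall i, cinteg (F i)) ->
  CI (fun z => \sum_(i < n) F i z) = \sum_(i < n) CI (F i) /\
  cinteg (fun z => \sum_(i < n) F i z).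
Proof.
elim: n F => [|n IH] F iF.
  rewrite (_ : (fun z => _) = fun=> 0); last by apply/funext => z; rewrite big_ord0.
  rewrite big_ord0; split.
    by apply: complex_ext; rewrite /= /dint /Rintegral integral0.
  by split; rewrite (_ : _ \o _ = cst 0%E) //; exact: integrable0.
rewrite (_ : (fun z => _) = fun z =>
   \sum_(i < n) F (widen_ord (leqnSn n) i) z + F ord_max z); last first.
  by apply/funext => z; rewrite big_ord_recr.
have [e1 e2] := IH (fun i => F (widen_ord (leqnSn n) i)) (fun i => iF _).
by rewrite CI_D // e1 big_ord_recr; split => //; exact: cintegD.
Qed.

Definition rot (zt : R[i]) (z : pt R) : pt R :=
  (cRe zt * z.1 - cIm zt * z.2, cIm zt * z.1 + cRe zt * z.2).

Lemma toC_rot zt z : toC (rot zt z) = zt * toC z.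
Proof. by apply: complex_ext; rewrite ?cReM ?cImM /=; ring. Qed.

Lemma absz_rot zt z : normc zt = 1 -> absz (rot zt z) = absz z.
Proof. by move=> o1; rewrite -!toC_normc toC_rot Normc.normcM o1 mul1r. Qed.

Lemma dint_rot zt (f : pt R -> R) : normc zt = 1 -> measurable_fun setT f ->
  dint (fun z => f (rot zt z)) = dint f.
Proof.
move=> o1 mf; rewrite /dint /Rintegral; congr fine.
apply: (@dA_preserving R (rot zt) (EFin \o f)).
- exact: measurable_rot.
- exact/measurable_EFinP.
- move=> g mg g0; apply: ge0_dA_rot => //.
  by rewrite -normc_sqr o1 expr1n.
Qed.

Lemma CI_rot zt f : normc zt = 1 -> cmeas f -> CI (fun z => f (rot zt z)) = CI f.
Proof.
move=> o1 [f1 f2]; apply: complex_ext => /=.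
  exact: (dint_rot o1 f1).
exact: (dint_rot o1 f2).
Qed.

(** Rotation by a unit zt with zt^j conj(zt)^k = -1 preserves the radial weight and turns the
    integrand into its opposite, so the integral equals its own negative. *)
Lemma CI_monomial_ortho j k (h : pt R -> R) : j != k ->
  measurable_fun setT h -> (forall z w, absz z = absz w -> h z = h w) ->
  integ (fun z => absz z ^+ (j + k) * `|h z|) ->
  CI (fun z => toC z ^+ j * conjc (toC z) ^+ k * (h z)%:C%C) = 0.
Proof.
move=> jk mh rh ih; have [zt o1 oe] := exists_unit_root_m1 R jk.
set F := fun z => _.
have mF : cmeas F.
  by apply: cmeasM; [apply: cmeasM; apply: cmeasX; [|apply: cmeasJ]; exact: cmeas_toC
    |exact: cmeas_real].
have iF : cinteg F.
  apply: (cinteg_le mF ih) => z.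
  by rewrite /F !Normc.normcM !normcX normc_conjc toC_normc exprD normc_real.
have := CI_rot o1 mF.
rewrite (@eq_CI _ (fun z => -1 * F z)); last first.
  move=> z; rewrite /F toC_rot (rh _ z) ?absz_rot // rmorphM /= !exprMn -oe; ring.
rewrite CI_Zl // mulN1r => /eqP.
by rewrite eq_sym -subr_eq0 opprK -mulr2n mulrn_eq0 /= => /eqP.
Qed.

(** Convergence of real and imaginary parts, the form in which [entire] states it; results on real
    sequences then apply to each component. *)
Definition ccvg (u : nat -> R[i]) (l : R[i]) :=
  ((fun n => cRe (u n)) @ \oo --> cRe l) /\ ((fun n => cIm (u n)) @ \oo --> cIm l).

Lemma ccvg_unique u l l' : ccvg u l -> ccvg u l' -> l = l'.
Proof.
move=> [a b] [c d]; apply: complex_ext; first exact: cvg_unique a c.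
exact: cvg_unique b d.
Qed.

Lemma ccvg_near_cst (u : nat -> R[i]) l N : (forall n, (N <= n)%N -> u n = l) -> ccvg u l.
Proof.
move=> h; split; apply: cvg_near_cst.
  by exists N => // n /= Nn; rewrite h.
by exists N => // n /= Nn; rewrite h.
Qed.

Lemma ccvgM u v l l' : ccvg u l -> ccvg v l' -> ccvg (fun n => u n * v n) (l * l').
Proof.
move=> [a b] [c d]; split.
  under eq_fun do rewrite cReM.
  by rewrite cReM; apply: cvgB; exact: cvgM.
under eq_fun do rewrite cImM.
by rewrite cImM; apply: cvgD; exact: cvgM.
Qed.

Lemma ccvgJ u l : ccvg u l -> ccvg (fun n => conjc (u n)) (conjc l).
Proof.
move=> [a b]; split.
  by under eq_fun do rewrite cReJ; rewrite cReJ.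
by under eq_fun do rewrite cImJ; rewrite cImJ; exact: cvgN.
Qed.

Lemma ccvg_cst c : ccvg (fun=> c) c.
Proof. exact: (@ccvg_near_cst _ _ 0). Qed.

Lemma cmeas_ccvg (u : nat -> pt R -> R[i]) f : (forall n, cmeas (u n)) ->
  (forall z, ccvg (u^~ z) (f z)) -> cmeas f.
Proof.
move=> mu cu; split.
  apply: (measurable_fun_cvg (h := fun n z => cRe (u n z))) => [n|z _].
    exact: (mu n).1.
  exact: (cu z).1.
apply: (measurable_fun_cvg (h := fun n z => cIm (u n z))) => [n|z _].
  exact: (mu n).2.
exact: (cu z).2.
Qed.

Lemma dint_dct (u : nat -> pt R -> R) (f G : pt R -> R) :
  (forall n, measurable_fun setT (u n)) -> measurable_fun setT f ->
  (forall z, u^~ z @ \oo --> f z) -> integ G -> (forall n z, `|u n z| <= G z) ->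
  (fun n => dint (u n)) @ \oo --> dint f.
Proof.
move=> mu mf cu iG uG.
have h1 n : measurable_fun setT (EFin \o u n) by exact/measurable_EFinP.
have h2 : measurable_fun setT (EFin \o f) by exact/measurable_EFinP.
have h3 : {ae dA, forall z, setT z -> (EFin \o u n) z @[n --> \oo] --> (EFin \o f) z}.
  by apply: aeW => z _; apply: cvg_EFin; [exact: nearW|exact: cu].
have h4 : {ae dA, forall z n, setT z -> (`|(EFin \o u n) z| <= (EFin \o G) z)%E}.
  by apply: aeW => z n _; rewrite /= lee_fin.
have [fi _ h] := @dominated_convergence _ _ R dA setT measurableT _ _ _ h1 h2 h3 iG h4.
apply: fine_cvg; rewrite /dint /Rintegral fineK //.
exact: integrable_fin_num fi.
Qed.

Lemma CI_dct (u : nat -> pt R -> R[i]) f (G : pt R -> R) :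
  (forall n, cmeas (u n)) -> (forall z, ccvg (u^~ z) (f z)) ->
  integ G -> (forall n z, normc (u n z) <= G z) ->
  ccvg (fun n => CI (u n)) (CI f).
Proof.
move=> mu cu iG uG; have [mf1 mf2] := cmeas_ccvg mu cu.
split => /=; apply: (dint_dct _ _ _ iG) => // [n|z|n z].
- exact: (mu n).1.
- exact: (cu z).1.
- exact: le_trans (cRe_le_normc _) (uG n z).
- exact: (mu n).2.
- exact: (cu z).2.
- exact: le_trans (cIm_le_normc _) (uG n z).
Qed.

End complex_integral.

(** * Power series coefficients and the reproducing kernel *)

Section coefficients.
Variable R : realType.
Local Notation dA := (@dA R).
Local Notation integ f := (dA.-integrable setT (EFin \o f)).

Definition psum (a : nat -> R[i]) (x : R[i]) N := \sum_(n < N) a n * x ^+ n.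

Lemma cvg_norm_le (u : nat -> R) (l : R) : u @ \oo --> l -> exists B, forall n, `|u n| <= B.
Proof.
move=> ul; have : cvgn u by apply/cvg_ex; exists l.
move=> /cvg_seq_bounded /pinfty_ex_gt0[B _ h]; exists B => n; exact: h.
Qed.

Lemma sum_half N : \sum_(i < N) (2^-1 : R) ^+ i <= 2.
Proof.
suff -> : \sum_(i < N) (2^-1 : R) ^+ i = 2 - 2 * 2^-1 ^+ N.
  by rewrite lerBlDr lerDl mulr_ge0 // exprn_ge0.
elim: N => [|N IH]; first by rewrite big_ord0 expr0; ring.
by rewrite big_ord_recr /= IH exprS; field.
Qed.

(** Convergence at the point 2 r bounds the partial sums there by B, hence each term, a difference
    of two of them, by 2 B. On the disc of radius r the terms gain a factor 2^-n, and the geometric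
    series gives 4 B. *)
Lemma psum_bounded (a : nat -> R[i]) (f : pt R -> R[i]) rho :
  (forall z, ccvg (psum a (toC z)) (f z)) ->
  exists2 M, 0 <= M & forall N z, absz z <= rho -> normc (psum a (toC z) N) <= M.
Proof.
move=> ca; pose r := `|rho| + 1.
have r0 : 0 < r by rewrite ltr_wpDl.
have [/cvg_norm_le[B1 h1] /cvg_norm_le[B2 h2]] := ca (2 * r, 0).
set x0 := toC (2 * r, 0) in h1 h2.
have nx0 : normc x0 = 2 * r.
  by rewrite /x0 [toC _]/((2 * r)%:C%C) normc_real ger0_norm // mulr_ge0 // ltW.
pose B := B1 + B2.
have hB N : normc (psum a x0 N) <= B.
  by apply: le_trans (normc_le _) _; apply: lerD.
have ht n : normc (a n) * (2 * r) ^+ n <= 2 * B.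
  rewrite -nx0 -normcX -Normc.normcM.
  have -> : a n * x0 ^+ n = psum a x0 n.+1 + - psum a x0 n.
    by rewrite /psum big_ord_recr /= [X in X - _]addrC addrK.
  apply: le_trans (le_normcD _ _) _; rewrite normcN mulr_natl mulr2n; exact: lerD.
have B0 : 0 <= B by apply: le_trans (hB 0%N); exact: normc_ge0.
exists (4 * B) => [|N z zr]; first by rewrite mulr_ge0.
have zr' : absz z <= r by apply: le_trans zr _; rewrite /r (le_trans (ler_norm _)) // lerDl.
apply: le_trans (normc_sum _ _) _.
apply: (@le_trans _ _ (\sum_(i < N) 2 * B * 2^-1 ^+ i)).
  apply: ler_sum => i _; rewrite Normc.normcM normcX toC_normc.
  apply: (@le_trans _ _ (normc (a i) * r ^+ i)).
    by apply: ler_wpM2l; [exact: normc_ge0|rewrite lerXn2r ?nnegrE ?absz_ge0 // ltW].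
  rewrite exprVn ler_pdivlMr ?exprn_gt0 // -mulrA -exprMn [r * 2]mulrC; exact: ht.
rewrite -mulr_sumr (_ : 4 * B = 2 * B * 2); last by ring.
by apply: ler_wpM2l; [rewrite mulr_ge0|exact: sum_half].
Qed.

Lemma cmeas_psum a N : cmeas (fun z : pt R => psum a (toC z) N).
Proof.
apply: cmeas_sum => i; apply: cmeasM; first exact: cmeas_cst.
by apply: cmeasX; exact: cmeas_toC.
Qed.

Lemma cmeas_entire a (f : pt R -> R[i]) : (forall z, ccvg (psum a (toC z)) (f z)) -> cmeas f.
Proof. by apply: cmeas_ccvg => N; exact: cmeas_psum. Qed.

Lemma dint0 : dint (fun=> 0 : R) = 0.
Proof. by rewrite /dint /Rintegral integral0. Qed.

Lemma CI_real (h : pt R -> R) : CI (fun z => (h z)%:C%C) = (dint h)%:C%C.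
Proof. by apply: complex_ext => //=; exact: dint0. Qed.

Lemma toC_mulJ (z : pt R) n : toC z ^+ n * conjc (toC z) ^+ n = (absz z ^+ (2 * n))%:C%C.
Proof. by rewrite -exprMn mulcJ toC_normc exprM -rmorphXn. Qed.

Lemma measurable_trunc (h : pt R -> R) rho : measurable_fun setT h ->
  measurable_fun setT (fun z => if absz z < rho then h z else 0).
Proof.
move=> mh; apply: measurable_fun_ifT => //.
apply: measurable_fun_ltr; [exact: measurable_absz|exact: measurable_cst].
Qed.

Section inner.
Variables (a : nat -> R[i]) (f : pt R -> R[i]) (h : pt R -> R).
Hypothesis ca : forall z, ccvg (psum a (toC z)) (f z).
Hypothesis mh : measurable_fun setT h.
Hypothesis rh : forall z w, absz z = absz w -> h z = h w.
Hypothesis h0 : forall z, 0 <= h z.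
Hypothesis ih : forall k, integ (fun z => absz z ^+ k * h z).

Let ht rho z := if absz z < rho then h z else 0.
Let ht_ge0 rho z : 0 <= ht rho z. Proof. by rewrite /ht; case: ifP. Qed.
Let ht_le rho z : ht rho z <= h z. Proof. by rewrite /ht; case: ifP. Qed.
Let mht rho : measurable_fun setT (ht rho). Proof. exact: measurable_trunc. Qed.
Let iht rho k : integ (fun z => absz z ^+ k * `|ht rho z|).
Proof.
apply: (integ_le _ (ih k)) => [|z].
  apply: measurable_funM; first by apply: measurable_funX; exact: measurable_absz.
  by apply: measurableT_comp.
rewrite normrM !ger0_norm // ?exprn_ge0 ?absz_ge0 //.
by rewrite ler_wpM2l // exprn_ge0 // absz_ge0.
Qed.

(* Truncation to a disc is what makes the partial sums uniformly bounded; the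
   disc is then exhausted by dominated convergence. *)
Lemma inner_trunc n rho :
  CI (fun z => toC z ^+ n * conjc (f z) * (ht rho z)%:C%C) =
  conjc (a n) * (dint (fun z => absz z ^+ (2 * n) * ht rho z))%:C%C.
Proof.
have [M M0 hM] := psum_bounded rho ca.
pose u N z := toC z ^+ n * conjc (psum a (toC z) N) * (ht rho z)%:C%C.
have mu N : cmeas (u N).
  apply: cmeasM; last exact: cmeas_real.
  apply: cmeasM; first by apply: cmeasX; exact: cmeas_toC.
  by apply: cmeasJ; exact: cmeas_psum.
have cu z : ccvg (u^~ z) (toC z ^+ n * conjc (f z) * (ht rho z)%:C%C).
  apply: ccvgM; last exact: ccvg_cst.
  by apply: ccvgM; [exact: ccvg_cst|apply: ccvgJ].
have iG : integ (fun z => M * (absz z ^+ n * h z)) by exact: integZ.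
have uG N z : normc (u N z) <= M * (absz z ^+ n * h z).
  rewrite /u /ht; case: ifPn => zr.
    rewrite !Normc.normcM normcX toC_normc normc_conjc normc_real ger0_norm //.
    rewrite mulrA [M * _]mulrC ler_wpM2r // ler_wpM2l ?exprn_ge0 ?absz_ge0 //.
    by apply: hM; exact: ltW.
  by rewrite mulr0 Normc.normc0 !mulr_ge0 // exprn_ge0 // absz_ge0.
have := CI_dct mu cu iG uG.
(* By orthogonality only the term of index n survives integration, so the sequence is constant from
   n + 1 on, the first partial sum that contains this term. *)
move=> cv; apply: (ccvg_unique cv); apply: (@ccvg_near_cst _ _ _ n.+1) => N nN.
pose F (i : 'I_N) z := conjc (a i) * (toC z ^+ n * conjc (toC z) ^+ i * (ht rho z)%:C%C).
have mF0 i : cmeas (fun z => toC z ^+ n * conjc (toC z) ^+ i * (ht rho z)%:C%C).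
  apply: cmeasM; last exact: cmeas_real.
  by apply: cmeasM; apply: cmeasX; [|apply: cmeasJ]; exact: cmeas_toC.
have iF0 i : cinteg (fun z => toC z ^+ n * conjc (toC z) ^+ i * (ht rho z)%:C%C).
  apply: (cinteg_le (mF0 i) (iht rho (n + i))) => z.
  by rewrite !Normc.normcM !normcX normc_conjc toC_normc exprD normc_real.
have iF i : cinteg (F i).
  have mFi : cmeas (F i) by apply: cmeasM; [exact: cmeas_cst|exact: mF0].
  apply: (cinteg_le mFi (integZ (normc (a i)) (iht rho (n + i)))) => z.
  by rewrite /F !Normc.normcM !normcX !normc_conjc toC_normc exprD normc_real.
rewrite (@eq_CI _ _ (fun z => \sum_(i < N) F i z)); last first.
  move=> z; rewrite /u /psum rmorph_sum mulr_sumr mulr_suml; apply: eq_bigr => i _.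
  by rewrite /F rmorphM rmorphXn /=; ring.
rewrite (CI_sum iF).1 (bigD1 (Ordinal nN)) //= big1 ?addr0; last first.
  move=> i ni; rewrite /F CI_Zl // CI_monomial_ortho ?mulr0 //.
    by rewrite eq_sym.
  by move=> z w zw; rewrite /ht zw (rh zw).
rewrite /F CI_Zl //; congr (_ * _); rewrite -CI_real; apply: eq_CI => z.
by rewrite toC_mulJ -rmorphM.
Qed.

Lemma inner_coef n : integ (fun z => normc (f z) ^+ 2 * h z) ->
  CI (fun z => toC z ^+ n * conjc (f z) * (h z)%:C%C) =
  conjc (a n) * (dint (fun z => absz z ^+ (2 * n) * h z))%:C%C.
Proof.
move=> if2; have mf := cmeas_entire ca.
pose u k z := toC z ^+ n * conjc (f z) * (ht k%:R z)%:C%C.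
have htE z : exists N, forall k, (N <= k)%N -> ht k%:R z = h z.
  exists (Num.truncn (absz z)).+1 => k hk; rewrite /ht ifT //.
  by apply: lt_le_trans (truncnS_gt _) _; rewrite ler_nat.
have mu k : cmeas (u k).
  apply: cmeasM; last exact: cmeas_real.
  by apply: cmeasM; [apply: cmeasX; exact: cmeas_toC|exact: cmeasJ].
have cu z : ccvg (u^~ z) (toC z ^+ n * conjc (f z) * (h z)%:C%C).
  by have [N hN] := htE z; apply: (@ccvg_near_cst _ _ _ N) => k /hN; rewrite /u => ->.
(* With p = |z|^n and q = |f z|, the product p q is at most p^2 + q^2; square integrability of f
   makes this majorant integrable. *)
pose G z := absz z ^+ (2 * n) * h z + normc (f z) ^+ 2 * h z.
have iG : integ G by exact: integD.
have uG k z : normc (u k z) <= G z.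
  rewrite /u !Normc.normcM normcX toC_normc normc_conjc normc_real ger0_norm // /G -mulrDl.
  apply: (@le_trans _ _ (absz z ^+ n * normc (f z) * h z)).
    by rewrite ler_wpM2l // mulr_ge0 ?exprn_ge0 ?absz_ge0 ?normc_ge0.
  rewrite ler_wpM2r // mulnC exprM; set p := _ ^+ n; set q := normc _.
  have := sqr_ge0 (p - q); have := sqr_ge0 p; have := sqr_ge0 q; nra.
apply: (ccvg_unique (CI_dct mu cu iG uG)).
rewrite (_ : (fun k => _) = fun k => conjc (a n) *
   (dint (fun z => absz z ^+ (2 * n) * ht k%:R z))%:C%C); last first.
  by apply/funext => k; exact: inner_trunc.
apply: ccvgM; first exact: ccvg_cst.
split => /=; last exact: cvg_cst.
apply: (dint_dct _ _ _ (ih (2 * n))) => [k||z|k z].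
- by apply: measurable_funM => //; apply: measurable_funX; exact: measurable_absz.
- by apply: measurable_funM => //; apply: measurable_funX; exact: measurable_absz.
- apply: cvg_near_cst; have [N hN] := htE z; exists N => // k /= /hN ->.
  by [].
- rewrite ger0_norm ?mulr_ge0 ?exprn_ge0 ?absz_ge0 //.
  by rewrite ler_wpM2l // exprn_ge0 // absz_ge0.
Qed.

End inner.

Section kernel.
Variables (m : R) (m0 : 0 < m).

Lemma Gamma_ge0 s : 0 <= @Gamma R s.
Proof. by apply: Rintegral_ge0 => t _; rewrite mulr_ge0 ?powR_ge0 ?expR_ge0. Qed.

Definition dens_cst : R := m / (2 * pi * Gamma (2 / m)).

Lemma dens_cst_ge0 : 0 <= dens_cst.
Proof. by rewrite divr_ge0 ?mulr_ge0 ?pi_ge0 ?Gamma_ge0 // ltW. Qed.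

Definition expw (a : R) (z : pt R) := expR (- (a * powR (absz z) m)).

Lemma densE a z : dens a m z = dens_cst * powR a (2 / m) * expw a z.
Proof. by rewrite /dens /dens_cst /expw [m * _ / _]mulrAC. Qed.

Lemma measurable_expw a : measurable_fun setT (expw a).
Proof.
apply: (measurableT_comp (f := @expR R)) => //.
apply: measurable_funN; apply: measurable_funM => //.
exact: measurable_powR_absz.
Qed.

Lemma expw_gt0 a z : 0 < expw a z. Proof. exact: expR_gt0. Qed.

Lemma integ_expw a k : 0 < a -> integ (fun z => absz z ^+ k * expw a z).
Proof.
move=> a0; apply: rapid_integ; last by apply: rapidX; exact: rapid_exp.
apply: measurable_funM; first by apply: measurable_funX; exact: measurable_absz.
exact: measurable_expw.
Qed.

Lemma measurable_dens a : measurable_fun setT (dens a m : pt R -> R).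
Proof.
rewrite (_ : dens a m = fun z => dens_cst * powR a (2 / m) * expw a z); last first.
  by apply/funext => z; exact: densE.
by apply: measurable_funM => //; exact: measurable_expw.
Qed.

Lemma dens_ge0 a (z : pt R) : 0 <= dens a m z.
Proof.
rewrite densE; apply: mulr_ge0; last exact: ltW (expw_gt0 _ _).
by apply: mulr_ge0; [exact: dens_cst_ge0|exact: powR_ge0].
Qed.

Lemma integ_dens a k : 0 < a -> integ (fun z => absz z ^+ k * dens a m z).
Proof.
move=> a0; apply: eq_integrable (integZ (dens_cst * powR a (2 / m)) (integ_expw k a0)) => //.
by move=> z _ /=; rewrite densE; congr EFin; ring.
Qed.

Lemma dens_radial a (z w : pt R) : absz z = absz w -> dens a m z = dens a m w.
Proof. by rewrite /dens => ->. Qed.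

Definition dens_moment a n : R := dint (fun z => absz z ^+ (2 * n) * dens a m z).

Lemma inF2_monomial a n : 0 < a -> inF2 a m (fun w => toC w ^+ n).
Proof.
move=> a0; split.
  exists (fun k => (k == n)%:R) => z.
  suff : ccvg (psum (fun k => (k == n)%:R) (toC z)) (toC z ^+ n) by [].
  apply: (@ccvg_near_cst _ _ _ n.+1) => N nN.
  rewrite /psum (bigD1 (Ordinal nN)) //= eqxx mul1r big1 ?addr0 // => i ni.
  by rewrite (_ : (i == n :> nat) = false) ?mul0r //; apply/negbTE.
have /integrableP[_] := integ_dens (2 * n) a0; apply: le_lt_trans.
apply: ge0_le_integral => //.
- by move=> z _; rewrite lee_fin mulr_ge0 ?exprn_ge0 ?normc_ge0 ?dens_ge0.
- apply/measurable_EFinP; apply: measurable_funM; last exact: measurable_dens.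
  apply: measurable_funX; apply: measurable_normc; apply: cmeasX; exact: cmeas_toC.
- apply/measurable_EFinP; apply: measurableT_comp => //.
  apply: measurable_funM; last exact: measurable_dens.
  by apply: measurable_funX; exact: measurable_absz.
- move=> z _; rewrite /= lee_fin normcX toC_normc -exprM mulnC; exact: ler_norm.
Qed.

Lemma inF2_integ a f : inF2 a m f -> cmeas f /\ integ (fun z => normc (f z) ^+ 2 * dens a m z).
Proof.
move=> [[b cb] fin].
have mf : cmeas f by apply: (@cmeas_entire b) => z; have [] := cb z.
split => //; apply/integrableP; split.
  apply/measurable_EFinP; apply: measurable_funM; last exact: measurable_dens.
  by apply: measurable_funX; exact: measurable_normc.
apply: le_lt_trans fin; apply: ge0_le_integral => //.
- apply/measurable_EFinP; apply: measurableT_comp => //.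
  apply: measurable_funM; last exact: measurable_dens.
  by apply: measurable_funX; exact: measurable_normc.
- apply/measurable_EFinP; apply: measurable_funM; last exact: measurable_dens.
  by apply: measurable_funX; exact: measurable_normc.
- by move=> z _; rewrite /= ger0_norm // mulr_ge0 ?exprn_ge0 ?normc_ge0 ?dens_ge0.
Qed.

(** Testing the reproducing property on w^n, and reading the inner product off the power series b of
    K(., z), gives z^n = conj(b_n) times the n-th moment. At z = 1 this shows that the moment is not
    zero; at every z it then determines b_n. *)
Lemma kernel_series a K : 0 < a -> reproducing_kernel a m K ->
  (forall n, dens_moment a n != 0) /\
  forall w z, ccvg (psum (fun n => ((dens_moment a n)^-1)%:C%C) (toC w * conjc (toC z))) (K w z).
Proof.
move=> a0 rK.
have key z : exists2 b, (forall w, ccvg (psum b (toC w)) (K w z)) &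
    forall n, toC z ^+ n = conjc (b n) * (dens_moment a n)%:C%C.
  have [Kin Krep] := rK z; have [[b cb] _] := Kin.
  exists b => [w|n]; first by have [] := cb w.
  have inn : CI (fun w => toC w ^+ n * conjc (K w z) * (dens a m w)%:C%C) =
      conjc (b n) * (dens_moment a n)%:C%C; last first.
    by rewrite (Krep _ (inF2_monomial n a0)) cintE; exact: inn.
  apply: (@inner_coef b (fun w => K w z) (dens a m)).
  - by move=> w; have [] := cb w.
  - exact: measurable_dens.
  - exact: dens_radial.
  - exact: dens_ge0.
  - by move=> k; exact: integ_dens.
  - exact: (inF2_integ Kin).2.
have c0 n : dens_moment a n != 0.
  have [b _ /(_ n)] := key (1, 0); rewrite [toC _]/(1 : R[i]) expr1n => e.
  apply/eqP => cz; move: e; rewrite cz mulr0 => /eqP.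
  by rewrite oner_eq0.
split=> // w z; have [b cb eb] := key z.
have -> : psum (fun n => ((dens_moment a n)^-1)%:C%C) (toC w * conjc (toC z)) = psum b (toC w).
  apply/funext => N; apply: eq_bigr => n _.
  have : conjc (toC z ^+ n) = b n * (dens_moment a n)%:C%C.
    by rewrite eb rmorphM /= conjcK; congr (_ * _); apply: complex_ext; rewrite /= ?oppr0.
  rewrite exprMn rmorphXn /= => ->.
  rewrite fmorphV mulrC -!mulrA mulfV ?mulr1 1?mulrC //.
  by rewrite (inj_eq (@complexI R) _ 0).
exact: cb.
Qed.

End kernel.
End coefficients.

(** * Scaling of the moments and the kernel series E *)

Section mittag_leffler.
Variable R : realType.
Local Notation dA := (@dA R).
Local Notation integ f := (dA.-integrable setT (EFin \o f)).
Variables (m : R) (m0 : 0 < m).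
Variable K : R -> pt R -> pt R -> R[i].
Hypothesis hK : forall a, 0 < a -> reproducing_kernel a m (K a).

(* [moment n] and [kerfun] are I_n and E of the introduction. *)
Definition qpow (a : R) : R := powR a (2 / m).
Definition moment n : R := dint (fun z => absz z ^+ (2 * n) * expw m 1 z).

Lemma qpow_gt0 a : 0 < a -> 0 < qpow a. Proof. exact: powR_gt0. Qed.

Lemma qpow1 : qpow 1 = 1. Proof. by rewrite /qpow powR1. Qed.

Lemma absz_scale r (z : pt R) : 0 <= r -> absz (r * z.1, r * z.2) = r * absz z.
Proof.
by move=> r0; rewrite /absz /= !exprMn -mulrDr sqrtrM ?sqr_ge0 // sqrtr_sqr ger0_norm.
Qed.

Lemma EFin_dint (f : pt R -> R) : integ f -> (\int[dA]_z (f z)%:E)%E = (dint f)%:E.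
Proof. by move=> fi; rewrite /dint /Rintegral fineK //; exact: integrable_fin_num fi. Qed.

(** The dilation by r = a^(-1/m) turns a |z|^m into |z|^m. Its Jacobian r^2 and the factor r^(2 n)
    from the monomial make up the n + 1 powers of r^2 = 1 / [qpow a]. *)
Lemma moment_scale a n : 0 < a ->
  dint (fun z => absz z ^+ (2 * n) * expw m a z) = (qpow a) ^- n.+1 * moment n.
Proof.
move=> a0; pose r := powR a (- m^-1); have r0 : 0 < r by exact: powR_gt0.
have r2 : r ^+ 2 = (qpow a)^-1.
  by rewrite -powR_mulrn ?powR_ge0 // -powRrM -powRN; congr powR; rewrite mulNr mulrC.
have rm : powR r m = a^-1.
  by rewrite -powRrM mulNr mulVf ?gt_eqF // powR_inv1 // ltW.
have nn b (z : pt R) : (0 <= (absz z ^+ (2 * n) * expw m b z)%:E)%E.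
  by rewrite lee_fin mulr_ge0 ?exprn_ge0 ?absz_ge0 // ltW // expw_gt0.
have mm b : measurable_fun setT (fun z : pt R => (absz z ^+ (2 * n) * expw m b z)%:E).
  apply/measurable_EFinP; apply: measurable_funM; last exact: measurable_expw.
  by apply: measurable_funX; exact: measurable_absz.
have ii : integ (fun z => r ^+ (2 * n) * (absz z ^+ (2 * n) * expw m 1 z)).
  by apply: integZ; exact: integ_expw.
have key : (\int[dA]_z (absz z ^+ (2 * n) * expw m a z)%:E =
    (r ^+ 2)%:E * (r ^+ (2 * n) * moment n)%:E)%E.
  rewrite (ge0_dA_scale r0 (mm a) (nn a)); congr (_ * _)%E.
  transitivity (\int[dA]_z (r ^+ (2 * n) * (absz z ^+ (2 * n) * expw m 1 z))%:E)%E.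
    apply: eq_integral => z _; congr EFin.
    rewrite /expw absz_scale ?(ltW r0) // exprMn powRM ?absz_ge0 ?(ltW r0) // rm.
    by rewrite mulrA mulfV ?gt_eqF // mulrA.
  rewrite (EFin_dint ii) dintZ //; exact: integ_expw.
rewrite /dint /Rintegral key -EFinM /= mulrA -exprD -mulnS.
by rewrite exprM r2 exprVn.
Qed.

Lemma dens_momentE a n : 0 < a -> dens_moment m a n = dens_cst m * (qpow a) ^- n * moment n.
Proof.
move=> a0; rewrite /dens_moment.
have -> : (fun z => absz z ^+ (2 * n) * dens a m z) =
    (fun z => dens_cst m * qpow a * (absz z ^+ (2 * n) * expw m a z)).
  by apply/funext => z; rewrite densE /qpow; ring.
rewrite dintZ; last exact: integ_expw.
rewrite moment_scale // exprS invfM; field.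
by rewrite expf_neq0 ?gt_eqF ?qpow_gt0 //= gt_eqF // qpow_gt0.
Qed.

(** Positivity comes from the kernel and not from the Gamma integral: if the constant vanished, so
    would the moments, and no kernel could reproduce the monomials. *)
Lemma dens_cst_gt0 : 0 < dens_cst m.
Proof.
have [/(_ 0%N) + _] := kernel_series m0 ltr01 (hK ltr01).
rewrite dens_momentE // -mulrA mulf_eq0 negb_or lt_neqAle => /andP[k0 _].
by rewrite eq_sym k0 dens_cst_ge0.
Qed.

Lemma moment_gt0 n : 0 < moment n.
Proof.
have [/(_ n) + _] := kernel_series m0 ltr01 (hK ltr01).
rewrite dens_momentE // mulf_eq0 negb_or lt_neqAle => /andP[_ k0].
rewrite eq_sym k0; apply: Rintegral_ge0 => z _.
by rewrite mulr_ge0 ?exprn_ge0 ?absz_ge0 // ltW // expw_gt0.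
Qed.

Definition kerfun_sum (x : R) N : R := \sum_(n < N) x ^+ n / moment n.
Definition kerfun (x : R) : R := limn (kerfun_sum x).

Lemma dens_moment_term a n (x : R[i]) : 0 < a ->
  ((dens_moment m a n)^-1)%:C%C * x ^+ n = (dens_cst m)^-1%:C%C * (((moment n)^-1)%:C%C * ((qpow a)%:C%C * x) ^+ n).
Proof.
move=> a0; rewrite dens_momentE //; move: (dens_cst m) => k.
rewrite !invfM invrK exprMn -rmorphXn /= !rmorphM /=; ring.
Qed.

Lemma psum_real x N : psum (fun n => ((moment n)^-1)%:C%C) (x%:C%C) N = (kerfun_sum x N)%:C%C.
Proof.
rewrite /psum /kerfun_sum rmorph_sum; apply: eq_bigr => n _.
by rewrite rmorphM rmorphXn mulrC.
Qed.

Lemma kernel_cvg a w z : 0 < a ->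
  ccvg (fun N => (dens_cst m)^-1%:C%C *
     psum (fun n => ((moment n)^-1)%:C%C) ((qpow a)%:C%C * (toC w * conjc (toC z))) N) (K a w z).
Proof.
move=> a0; have [_ /(_ w z)] := kernel_series m0 a0 (hK a0).
set u := psum _ _; set v := fun N => _; suff -> : u = v by [].
apply/funext => N; rewrite /u /v /psum mulr_sumr; apply: eq_bigr => n _.
exact: dens_moment_term.
Qed.

(** Up to a constant factor this is the series of [K 1] (., 1) at the real point x, so convergence
    is part of the kernel being entire and no growth estimate for the moments enters. *)
Lemma kerfun_cvg x : kerfun_sum x @ \oo --> kerfun x.
Proof.
suff : cvgn (kerfun_sum x) by [].
have [+ _] := kernel_cvg (x, 0) (1, 0) ltr01.
have -> : toC (x, 0) * conjc (toC (1, 0)) = x%:C%C :> R[i].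
  by apply: complex_ext; rewrite ?cReM ?cImM /=; ring.
rewrite qpow1 mul1r; under eq_fun do rewrite psum_real -rmorphM /=.
set l := cRe _ => h; apply/cvg_ex; exists (dens_cst m * l).
have -> : kerfun_sum x = (fun N => dens_cst m * ((dens_cst m)^-1 * kerfun_sum x N)).
  by apply/funext => N; rewrite mulrA mulfV ?mul1r // gt_eqF // dens_cst_gt0.
by apply: cvgMr => //; exact: cvg_cst.
Qed.

(** Both kernels are limits of the same sequence, since the parameter enters the series only through
    [qpow a] times conj(z). This transfers a kernel from the weight of b to that of b + d. *)
Lemma kernel_eq a b w z z' : 0 < a -> 0 < b ->
  (qpow a)%:C%C * conjc (toC z) = (qpow b)%:C%C * conjc (toC z') -> K a w z = K b w z'.
Proof.
move=> a0 b0 e; apply: (ccvg_unique (kernel_cvg w z a0)).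
by have := kernel_cvg w z' b0; rewrite mulrCA -e mulrCA.
Qed.

Lemma kernel_real a w z x : 0 < a -> (qpow a)%:C%C * (toC w * conjc (toC z)) = x%:C%C ->
  K a w z = ((dens_cst m)^-1 * kerfun x)%:C%C.
Proof.
move=> a0 e; apply: (ccvg_unique (kernel_cvg w z a0)); rewrite e.
under eq_fun do rewrite psum_real -rmorphM.
split => /=; last exact: cvg_cst.
by apply: cvgMr; exact: kerfun_cvg.
Qed.

Lemma kernel_diag a z : 0 < a -> K a z z = ((dens_cst m)^-1 * kerfun (qpow a * absz z ^+ 2))%:C%C.
Proof. by move=> a0; apply: kernel_real => //; rewrite mulcJ toC_normc -rmorphM. Qed.

Lemma kerfun_sum_le x N : 0 <= x -> kerfun_sum x N <= kerfun x.
Proof.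
move=> x0; have cx : cvgn (kerfun_sum x) by apply/cvg_ex; exists (kerfun x); exact: kerfun_cvg.
apply: (nondecreasing_cvgn_le _ cx); apply/nondecreasing_seqP => n; rewrite /kerfun_sum big_ord_recr /= lerDl.
by rewrite divr_ge0 ?exprn_ge0 // ltW // moment_gt0.
Qed.

(** Two terms of a series with nonnegative terms. The first keeps E away from 0; the second makes 1
    / E decay faster than any power. *)
Lemma kerfun_ge x n : 0 <= x -> (moment 0)^-1 + x ^+ n.+1 / moment n.+1 <= kerfun x.
Proof.
move=> x0; apply: le_trans (kerfun_sum_le n.+2 x0); rewrite /kerfun_sum big_ord_recr /= lerD2r.
rewrite big_ord_recl /= expr0 mul1r lerDl; apply: sumr_ge0 => i _.
by rewrite divr_ge0 ?exprn_ge0 // ltW // moment_gt0.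
Qed.

Lemma kerfun_ge_moment0 x : 0 <= x -> (moment 0)^-1 <= kerfun x.
Proof.
move=> x0; apply: le_trans (kerfun_ge 0 x0).
by rewrite lerDl divr_ge0 ?exprn_ge0 // ltW // moment_gt0.
Qed.

Lemma kerfun_gt0 x : 0 <= x -> 0 < kerfun x.
Proof. by move=> x0; apply: lt_le_trans (kerfun_ge_moment0 x0); rewrite invr_gt0 moment_gt0. Qed.

Lemma kerfun0 : kerfun 0 = (moment 0)^-1.
Proof.
apply: cvg_lim => //; apply: cvg_near_cst.
exists 1%N => // -[//|N] _; rewrite /kerfun_sum big_ord_recl /= expr0 mul1r big1 ?addr0 // => i _.
by rewrite /= /bump /= add1n expr0n mul0r.
Qed.

(** Every term of positive order satisfies t^n <= t. Small t serves the limit d -> oo; x = 1 serves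
    as an upper bound of E near 0. *)
Lemma kerfun_scale_le x t : 0 <= x -> 0 <= t <= 1 -> kerfun (t * x) <= (moment 0)^-1 + t * (kerfun x - (moment 0)^-1).
Proof.
move=> x0 /andP[t0 t1].
have c1 : (fun N => (moment 0)^-1 + t * (kerfun_sum x N.+1 - (moment 0)^-1)) @ \oo -->
    (moment 0)^-1 + t * (kerfun x - (moment 0)^-1).
  apply: cvgD; first exact: cvg_cst.
  apply: cvgMr; apply: cvgB; last exact: cvg_cst.
  by have := @kerfun_cvg x; rewrite -(cvg_shiftS (kerfun_sum x)).
have c2 : (fun N => kerfun_sum (t * x) N.+1) @ \oo --> kerfun (t * x).
  by have := @kerfun_cvg (t * x); rewrite -(cvg_shiftS (kerfun_sum _)).
apply: (ler_cvg_to c2 c1); apply: nearW => N.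
rewrite /kerfun_sum !big_ord_recl !expr0 !mul1r lerD2l addrAC subrr add0r mulr_sumr.
apply: ler_sum => i _; rewrite mulrA ler_pM2r ?invr_gt0 ?moment_gt0 // exprMn.
rewrite ler_wpM2r ?exprn_ge0 // lift0 exprS.
by rewrite -[leRHS]mulr1 ler_wpM2l // exprn_ile1.
Qed.

Lemma kerfun_mono x y : 0 <= x -> x <= y -> kerfun x <= kerfun y.
Proof.
move=> x0 xy; apply: ler_lim; [by apply/cvg_ex; exists (kerfun x); exact: kerfun_cvg|
  by apply/cvg_ex; exists (kerfun y); exact: kerfun_cvg|].
apply: nearW => N; apply: ler_sum => i _; rewrite ler_pM2r ?invr_gt0 ?moment_gt0 //.
by rewrite lerXn2r // nnegrE // (le_trans x0).
Qed.

Lemma measurable_kerfun c : measurable_fun setT (fun z : pt R => kerfun (c * absz z ^+ 2)).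
Proof.
apply: (measurable_fun_cvg (h := fun N z => kerfun_sum (c * absz z ^+ 2) N)) => [N|z _].
  apply: measurable_sum => i; apply: measurable_funM => //.
  apply: measurable_funX; apply: measurable_funM => //.
  by apply: measurable_funX; exact: measurable_absz.
exact: kerfun_cvg.
Qed.

End mittag_leffler.

(** * Commutation at the origin forces m = 2 *)

Section real_lemmas.
Variable R : realType.

(** Stands for a passage to the limit t -> oo: an inequality that holds up to exponentially small
    errors holds exactly. *)
Lemma exp_small (D C1 C2 s : R) : 0 < s -> 0 <= C1 -> 0 <= C2 ->
  (forall t, 0 <= t -> D <= C1 * expR (- t) + C2 * expR (- (s * t))) -> D <= 0.
Proof.
move=> s0 c1 c2 h; rewrite leNgt; apply/negP => D0.
pose r := Num.min 1 s; have r0 : 0 < r by rewrite lt_min ltr01.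
(* With r t D = C1 + C2, the bound exp (r t) >= 1 + r t yields D + (C1 + C2) <= C1 + C2, against D >
   0. *)
pose t := (C1 + C2) / (r * D).
have t0 : 0 <= t by rewrite divr_ge0 ?addr_ge0 // ltW // mulr_gt0.
have e1 : expR (- t) <= expR (- (r * t)).
  by rewrite ler_expR lerN2 -[leRHS]mul1r ler_wpM2r // ge_min lexx.
have e2 : expR (- (s * t)) <= expR (- (r * t)).
  by rewrite ler_expR lerN2 ler_wpM2r // ge_min lexx orbT.
have hD : D <= (C1 + C2) * expR (- (r * t)).
  by rewrite mulrDl; apply: le_trans (h t t0) _; apply: lerD; exact: ler_wpM2l.
have : D * expR (r * t) <= C1 + C2.
  by rewrite -ler_pdivlMr ?expR_gt0 // -expRN.
have := ler_wpM2l (ltW D0) (expR_ge1Dx (r * t)).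
have -> : D * (1 + r * t) = D + (C1 + C2) by rewrite /t; field; rewrite !gt_eqF.
by move=> /le_trans /[apply]; rewrite gerDr leNgt D0.
Qed.

(** Convexity from two tangent-line bounds at the point e x: combined with weights 1 - e and e,
    their linear terms cancel. *)
Lemma exp_convex (e x : R) : 0 <= e <= 1 -> expR (- (e * x)) <= 1 - e + e * expR (- x).
Proof.
move=> /andP[e0 e1]; set y := expR (- (e * x)).
have y0 : 0 < y by exact: expR_gt0.
have h1 : y * (1 + e * x) <= 1.
  by rewrite -ler_pdivlMl // mulr1 -expRN opprK expR_ge1Dx.
have h2 : y * (1 - (1 - e) * x) <= expR (- x).
  rewrite (_ : - x = - (e * x) - (1 - e) * x); last by ring.
  by rewrite expRD ler_pM2l // expR_ge1Dx.
nra.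
Qed.

End real_lemmas.

Section commutation.
Variable R : realType.
Local Notation dA := (@dA R).
Local Notation integ f := (dA.-integrable setT (EFin \o f)).
Variables (m : R) (m0 : 0 < m).
Variable K : R -> pt R -> pt R -> R[i].
Hypothesis hK : forall a, 0 < a -> reproducing_kernel a m (K a).
Local Notation E := (kerfun m).
Local Notation q := (qpow m).
Local Notation gw := (expw m).
Local Notation mom := (moment m).
Local Notation kappa := (dens_cst m).

Let momp n : 0 < mom n. Proof. exact: (moment_gt0 m0 hK n). Qed.
Let kp : 0 < kappa. Proof. exact: (dens_cst_gt0 m0 hK). Qed.
Let Ep x : 0 <= x -> 0 < E x. Proof. exact: (kerfun_gt0 m0 hK). Qed.
Let gwp a z : 0 < gw a z. Proof. exact: expw_gt0. Qed.

Lemma X_ge0 a (z : pt R) : 0 < a -> 0 <= q a * absz z ^+ 2.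
Proof. by move=> a0; rewrite mulr_ge0 ?sqr_ge0 // ltW // qpow_gt0. Qed.

(** The reproducing property is applied to the kernel function itself. *)
Lemma kernel_norm a z : 0 < a ->
  integ (fun w => normc (K a w z) ^+ 2 * dens a m w) /\
  dint (fun w => normc (K a w z) ^+ 2 * dens a m w) =
  kappa^-1 * E (q a * absz z ^+ 2).
Proof.
move=> a0; have [Kin Krep] := hK a0 z.
split; first exact: (inF2_integ m0 Kin).2.
apply: (@complexI R); rewrite -CI_real -(kernel_diag m0 hK z a0) (Krep _ Kin) cintE.
by apply: eq_CI => w; rewrite conj_conjc mulcJ -rmorphM.
Qed.

Definition tau b d := q b / q (b + d).

Lemma tau_gt0 b d : 0 < b -> 0 < d -> 0 < tau b d.
Proof. by move=> b0 d0; rewrite divr_gt0 ?qpow_gt0 // addr_gt0. Qed.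

Lemma qpow_mono b c : 0 < b -> b <= c -> q b <= q c.
Proof.
move=> b0 bc; apply: ge0_ler_powR; rewrite ?nnegrE ?divr_ge0 // ?ltW //.
exact: lt_le_trans bc.
Qed.

Lemma tau_le1 b d : 0 < b -> 0 < d -> tau b d <= 1.
Proof.
by move=> b0 d0; rewrite ler_pdivrMr ?qpow_gt0 ?addr_gt0 // mul1r qpow_mono // lerDl ltW.
Qed.

(** The factor t of the transform of f_d is kept apart: it tends to 0 as d -> oo, whereas this
    quotient tends to E 0 / E x with x = [q b * absz z ^+ 2]. *)
Definition Phi b t (z : pt R) := E (t * (q b * absz z ^+ 2)) / E (q b * absz z ^+ 2).

(** Multiplication by f_d turns the weight of b into that of b + d up to a constant, and [K b] at z
    is [K (b + d)] at t z because q(b + d) t = q b. The integral becomes the squared norm of a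
    kernel function, which [kernel_norm] evaluates. *)
Lemma berezin_fdelta b d : 0 < b -> 0 < d ->
  berezin b m (K b) (fdelta d m) = fun z => (tau b d * Phi b (tau b d) z)%:C%C.
Proof.
move=> b0 d0; apply/funext => z; rewrite /berezin cintE.
have g0 : 0 < b + d by rewrite addr_gt0.
set t := tau b d; have t0 : 0 < t by exact: tau_gt0.
pose z' : pt R := (t * z.1, t * z.2).
have qt : q (b + d) * t = q b by rewrite /t /tau mulrC divfK // gt_eqF // qpow_gt0.
have eK w : K b w z = K (b + d) w z'.
  apply: (kernel_eq m0 hK w b0 g0).
  have -> : conjc (toC z') = t%:C%C * conjc (toC z).
    by apply: complex_ext; rewrite ?cReM ?cImM /=; ring.
  by rewrite mulrA -rmorphM qt.
have [ik ek] := kernel_norm z' g0.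
have kn : kappa != 0 by rewrite gt_eqF.
have en : E (q b * absz z ^+ 2) != 0 by rewrite gt_eqF // Ep // X_ge0.
rewrite (@eq_CI _ _ (fun w => (t * kappa / E (q b * absz z ^+ 2) *
    (normc (K (b + d) w z') ^+ 2 * dens (b + d) m w))%:C%C)); last first.
  move=> w; rewrite eK (kernel_diag m0 hK z b0) /fdelta -fmorphV -!rmorphM; congr (_%:C)%C.
  have -> : dens b m w = t * kappa * q (b + d) * gw b w by rewrite densE -/(q b) -qt; ring.
  rewrite densE -/(gw d w) -/(q (b + d)).
  have -> : gw (b + d) w = gw b w * gw d w by rewrite /expw -expRD mulrDl opprD.
  by field; rewrite kn en.
rewrite CI_real dintZ // ek /Phi absz_scale ?(ltW t0) //; congr (_%:C)%C.
have -> : q (b + d) * (t * absz z) ^+ 2 = t * (q b * absz z ^+ 2) by rewrite -qt; ring.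
by field; rewrite kn en.
Qed.

(** K(., 0) is constant, as only the term E 0 = 1 / I_0 of the series is left, so the transform at
    the origin is a plain weighted mean. *)
Lemma berezin_at0 a (phi : pt R -> R) : 0 < a -> integ (fun z => phi z * gw a z) ->
  berezin a m (K a) (fun z => (phi z)%:C%C) (0, 0) =
  (q a / mom 0 * dint (fun w => phi w * gw a w))%:C%C.
Proof.
move=> a0 ip; rewrite /berezin cintE.
have eK w : K a w (0, 0) = (kappa^-1 * (mom 0)^-1)%:C%C.
  rewrite -(kerfun0 m); apply: (kernel_real m0 hK a0).
  by apply: complex_ext; rewrite ?cReM ?cImM /=; ring.
rewrite (@eq_CI _ _ (fun w => (q a / mom 0 * (phi w * gw a w))%:C%C)); last first.
  move=> w; rewrite !eK normc_real real_normK ?num_real // -fmorphV -!rmorphM.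
  congr (_%:C)%C; rewrite densE -/(q a) -/(gw a w).
  by field; rewrite !gt_eqF.
by rewrite CI_real dintZ.
Qed.

Definition J a b := dint (fun z => gw a z / E (q b * absz z ^+ 2)).

Lemma integ_expw0 a : 0 < a -> integ (gw a).
Proof. by move=> a0; apply: eq_integrable (integ_expw m0 0 a0) => // z _; rewrite /= mul1r. Qed.

Lemma measurable_kerfun_inv b : 0 < b ->
  measurable_fun setT (fun z : pt R => (E (q b * absz z ^+ 2))^-1).
Proof.
move=> b0; have -> : (fun z : pt R => (E (q b * absz z ^+ 2))^-1) =
    fun z => powR (E (q b * absz z ^+ 2)) (-1).
  by apply/funext => z; rewrite powR_inv1 // ltW // Ep // X_ge0.
by apply: (measurableT_comp (measurable_powR (-1))); exact: (measurable_kerfun m0 hK).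
Qed.

Lemma integ_J a b : 0 < a -> 0 < b -> integ (fun z => gw a z / E (q b * absz z ^+ 2)).
Proof.
move=> a0 b0; apply: (integ_le _ (integZ (mom 0) (integ_expw0 a0))) => [|z].
  by apply: measurable_funM; [exact: measurable_expw|exact: measurable_kerfun_inv].
have X0 := X_ge0 z b0; have e0 := kerfun_ge_moment0 m0 hK X0.
have p : 0 <= gw a z / E (q b * absz z ^+ 2) by rewrite divr_ge0 // ltW // Ep.
rewrite ger0_norm // mulrC ler_pM2r //.
by rewrite -[leRHS]invrK lef_pV2 ?posrE ?Ep ?invr_gt0.
Qed.

(** The error t is uniform in z because E (t x) - E 0 <= t (E x - E 0), so it integrates against
    every weight. *)
Lemma Phi_bounds b t z : 0 < b -> 0 <= t <= 1 ->
  (mom 0)^-1 / E (q b * absz z ^+ 2) <= Phi b t z <= (mom 0)^-1 / E (q b * absz z ^+ 2) + t.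
Proof.
move=> b0 t01; have X0 := X_ge0 z b0; have [t0 t1] := andP t01.
have e0 := Ep X0; apply/andP; split.
  by rewrite ler_pM2r ?invr_gt0 // (kerfun_ge_moment0 m0 hK) // mulr_ge0.
rewrite /Phi ler_pdivrMr // mulrDl divfK ?gt_eqF //.
apply: le_trans (kerfun_scale_le m0 hK X0 t01) _; rewrite lerD2l ler_wpM2l // gerBl.
by rewrite invr_ge0 ltW.
Qed.

Lemma measurable_Phi b t : 0 < b -> measurable_fun setT (Phi b t).
Proof.
move=> b0; apply: measurable_funM; last exact: measurable_kerfun_inv.
have -> : (fun z : pt R => E (t * (q b * absz z ^+ 2))) =
  (fun z : pt R => E (t * q b * absz z ^+ 2)) by apply/funext => z; rewrite mulrA.
exact: (measurable_kerfun m0 hK).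
Qed.

Lemma Phi_ge0 b t z : 0 < b -> 0 <= t -> 0 <= Phi b t z.
Proof.
by move=> b0 t0; apply: divr_ge0; apply/ltW/Ep; rewrite ?(mulr_ge0 t0) ?X_ge0.
Qed.

Lemma Phi_le1 b t z : 0 < b -> 0 <= t <= 1 -> Phi b t z <= 1.
Proof.
move=> b0 /andP[t0 t1]; have X0 := X_ge0 z b0; rewrite ler_pdivrMr ?Ep // mul1r.
by apply: (kerfun_mono m0 hK); [exact: mulr_ge0|rewrite -[leRHS]mul1r; exact: ler_wpM2r].
Qed.

Lemma integ_Phi a b t : 0 < a -> 0 < b -> 0 <= t <= 1 -> integ (fun z => Phi b t z * gw a z).
Proof.
move=> a0 b0 t01; have [t0 t1] := andP t01; apply: (integ_le _ (integ_expw0 a0)) => [|z].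
  by apply: measurable_funM; [exact: measurable_Phi|exact: measurable_expw].
have p0 := Phi_ge0 z b0 t0.
by rewrite normrM (ger0_norm p0) gtr0_norm // -[leRHS]mul1r ler_pM2r // Phi_le1.
Qed.

Lemma dint_Phi_bounds a b t : 0 < a -> 0 < b -> 0 <= t <= 1 ->
  (mom 0)^-1 * J a b <= dint (fun z => Phi b t z * gw a z)
    <= (mom 0)^-1 * J a b + t * dint (gw a).
Proof.
move=> a0 b0 t01; have iJ := integ_J a0 b0; have iP := integ_Phi a0 b0 t01.
rewrite /J -dintZ // -dintZ; last exact: integ_expw0.
rewrite -dintD; [|exact: integZ|by apply: integZ; exact: integ_expw0].
apply/andP; split; apply: dint_le => //.
- exact: integZ.
- move=> z; have /andP[h _] := Phi_bounds z b0 t01.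
  by rewrite [gw a z / _]mulrC mulrA ler_pM2r.
- by apply: integD; apply: integZ => //; exact: integ_expw0.
- move=> z; have /andP[_ h] := Phi_bounds z b0 t01.
  by rewrite [gw a z / _]mulrC mulrA -mulrDl ler_pM2r.
Qed.

Hypothesis comm0 : forall a b d, 0 < a -> 0 < b -> 0 < d ->
  berezin a m (K a) (berezin b m (K b) (fdelta d m)) (0, 0)
  = berezin b m (K b) (berezin a m (K a) (fdelta d m)) (0, 0).

(** At the origin each side is q a q b / I_0 times an integral, divided by q(b + d) or q(a + d); the
    symmetric factor cancels. *)
Lemma comm0_Phi a b d : 0 < a -> 0 < b -> 0 < d ->
  q (a + d) * dint (fun z => Phi b (tau b d) z * gw a z) =
  q (b + d) * dint (fun z => Phi a (tau a d) z * gw b z).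
Proof.
move=> a0 b0 d0.
have aux x y : 0 < x -> 0 < y ->
  berezin x m (K x) (berezin y m (K y) (fdelta d m)) (0, 0) =
  (q x * q y / (mom 0 * q (y + d)) * dint (fun z => Phi y (tau y d) z * gw x z))%:C%C.
  move=> x0 y0; have t01 : 0 <= tau y d <= 1 by rewrite ltW ?tau_gt0 // tau_le1.
  have iP := integ_Phi x0 y0 t01.
  rewrite berezin_fdelta // berezin_at0 //.
    under eq_dint do rewrite -mulrA.
    rewrite dintZ // /tau; congr (_%:C)%C; field.
    by rewrite !gt_eqF // qpow_gt0 // addr_gt0.
  by apply: eq_integrable (integZ (tau y d) iP) => // z _; rewrite /= mulrA.
have := comm0 a0 b0 d0; rewrite (aux _ _ a0 b0) (aux _ _ b0 a0) => /(@complexI R).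
move: (dint _) (dint _) => v u h.
have qa : q a != 0 by rewrite gt_eqF // qpow_gt0.
have qb : q b != 0 by rewrite gt_eqF // qpow_gt0.
have qad : q (a + d) != 0 by rewrite gt_eqF // qpow_gt0 // addr_gt0.
have qbd : q (b + d) != 0 by rewrite gt_eqF // qpow_gt0 // addr_gt0.
have mo : mom 0 != 0 by rewrite gt_eqF.
transitivity (q (a + d) * q (b + d) * mom 0 / (q a * q b) * (q a * q b / (mom 0 * q (b + d)) * u)).
  by field; rewrite qa qb mo qbd.
by rewrite h; field; rewrite qa qb mo qad.
Qed.

(** Writing d = e^t makes [q d] an exponential in t, so that all errors take the form treated by
    [exp_small]. *)
Lemma qpow_expR t : q (expR t) = expR (2 / m * t).
Proof. by rewrite mulrC expRM. Qed.

Lemma tau_small b t : 0 < b -> tau b (expR t) <= q b * expR (- (2 / m * t)).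
Proof.
move=> b0; rewrite expRN -qpow_expR ler_pM2l ?qpow_gt0 // lef_pV2 ?posrE ?qpow_gt0 ?expR_gt0 ?addr_gt0 ?expR_gt0 //.
by rewrite qpow_mono ?expR_gt0 // lerDr ltW.
Qed.

Lemma qpow_ratio a b t : 0 < b -> b <= a -> 0 <= t ->
  q (a + expR t) <= q (b + expR t) *
    (1 + 2 / m * a * expR (2 / m * a) * expR (- t)).
Proof.
move=> b0 ba t0; have a0 : 0 < a := lt_le_trans b0 ba.
have s0 : 0 < 2 / m by rewrite divr_gt0.
(* Since e^t e^y >= e^t + a, the ratio of the two powers is at most e^(s y) with s = 2 / m. Then e^x
   <= 1 + x e^x and y <= a give the stated constant. *)
pose y := a * expR (- t); have y0 : 0 <= y by rewrite mulr_ge0 ?expR_ge0 // ltW.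
have bd : 0 < b + expR t by rewrite addr_gt0 // expR_gt0.
apply: (@le_trans _ _ (q (b + expR t) * expR (2 / m * y))).
  rewrite -qpow_expR /qpow -powRM; [|exact: ltW|exact: expR_ge0].
  apply: ge0_ler_powR; rewrite ?nnegrE ?(ltW s0) ?mulr_ge0 ?expR_ge0 ?(ltW bd) //.
    by rewrite addr_ge0 ?expR_ge0 // ltW.
  have e1 : expR t * expR y <= (b + expR t) * expR y.
    by rewrite ler_pM2r ?expR_gt0 // lerDr ltW.
  apply: le_trans e1; have := ler_wpM2l (expR_ge0 t) (expR_ge1Dx y).
  apply: le_trans; rewrite mulrDr mulr1 /y mulrCA -expRD subrr expR0 mulr1.
  by rewrite addrC.
rewrite ler_pM2l ?qpow_gt0 //; set x := 2 / m * y.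
have x0 : 0 <= x by rewrite mulr_ge0 // ltW.
have ya : y <= a by rewrite -[leRHS]mulr1 ler_wpM2l ?(ltW a0) // -expR0 ler_expR oppr_le0.
have xa : expR x <= expR (2 / m * a) by rewrite ler_expR ler_wpM2l // ltW.
have h : expR x * (1 - x) <= 1.
  by rewrite -ler_pdivlMl ?expR_gt0 // mulr1 -expRN expR_ge1Dx.
apply: (@le_trans _ _ (1 + x * expR x)); first by move: h; rewrite mulrBr mulr1 mulrC; lra.
rewrite lerD2l (_ : 2 / m * a * _ * _ = x * expR (2 / m * a)); last by rewrite /x /y; ring.
exact: ler_wpM2l.
Qed.

Lemma J_ge0 a b : 0 < b -> 0 <= J a b.
Proof.
move=> b0; apply: Rintegral_ge0 => z _; rewrite divr_ge0 // ltW //.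
by rewrite Ep // X_ge0.
Qed.

(** u and v exceed ja and jb by exponentially small amounts. As b <= a, monotonicity of q gives u <=
    v and hence ja <= jb; the converse rests on q(a + d) / q(b + d) being 1 + O(1 / d). *)
Lemma J_sym_aux a b (ja jb : R) : 0 < b -> b <= a -> 0 <= ja -> 0 <= jb ->
  (forall t, 0 <= t -> exists u v, [/\ q (a + expR t) * u = q (b + expR t) * v,
    ja <= u <= ja + tau b (expR t) * dint (gw a) &
    jb <= v <= jb + tau a (expR t) * dint (gw b)]) -> ja = jb.
Proof.
move=> b0 ba Ja Jb bounds; have a0 : 0 < a := lt_le_trans b0 ba.
have s0 : 0 < 2 / m by rewrite divr_gt0.
have Mp x : 0 <= dint (gw x) by apply: Rintegral_ge0 => z _; exact/ltW/gwp.
(* Hides the integrals, on which conversion would get lost. *)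
have [M eM] : exists M, M = fun x => dint (gw x) by exists (fun x => dint (gw x)).
have {}Mp x : 0 <= M x by rewrite eM; exact: Mp.
have {}bounds t : 0 <= t -> exists u v, [/\ q (a + expR t) * u = q (b + expR t) * v,
    ja <= u <= ja + tau b (expR t) * M a & jb <= v <= jb + tau a (expR t) * M b].
  by rewrite eM; exact: bounds.
apply/eqP; rewrite eq_le -[ja <= _]subr_le0 -[jb <= _]subr_le0.
apply/andP; split.
  apply: (@exp_small _ _ 0 (q a * M b) (2 / m)) => //.
    by rewrite mulr_ge0 // ltW // qpow_gt0.
  move=> t t0; have [u [v [e /andP[u1 u2] /andP[v1 v2]]]] := bounds t t0.
  have d0 := expR_gt0 t.
  have uv : u <= v.
    rewrite -(ler_pM2l (qpow_gt0 m (addr_gt0 a0 d0))) e ler_wpM2r //.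
      exact: le_trans v1.
    by rewrite qpow_mono ?addr_gt0 // lerD2r.
  have := ler_wpM2r (Mp b) (tau_small t a0).
  have -> : q a * M b * expR (- (2 / m * t)) = q a * expR (- (2 / m * t)) * M b by ring.
  by rewrite mul0r add0r; lra.
pose C0 := 2 / m * a * expR (2 / m * a).
have C00 : 0 <= C0 by rewrite !mulr_ge0 ?expR_ge0 // ltW // invr_gt0.
apply: (@exp_small _ _ (C0 * (ja + M a)) (q b * M a) (2 / m)) => //.
- by rewrite mulr_ge0 // addr_ge0.
- by rewrite mulr_ge0 // ltW // qpow_gt0.
move=> t t0; have [u [v [e /andP[u1 u2] /andP[v1 v2]]]] := bounds t t0.
have d0 := expR_gt0 t; have qbd := qpow_gt0 m (addr_gt0 b0 d0).
have u0 : 0 <= u by exact: le_trans u1.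
have vu : v <= (1 + C0 * expR (- t)) * u.
  rewrite -(ler_pM2l qbd) -e mulrA ler_wpM2r //; exact: qpow_ratio.
have h1 := ler_wpM2r (Mp a) (tau_small t b0).
have h2 : tau b (expR t) * M a <= M a by rewrite -[leRHS]mul1r ler_wpM2r // tau_le1.
have h3 : C0 * expR (- t) * u <= C0 * expR (- t) * (ja + M a).
  by apply: ler_wpM2l; [rewrite mulr_ge0 // expR_ge0|apply: le_trans u2 _; rewrite lerD2l].
have e1 : q b * M a * expR (- (2 / m * t)) = q b * expR (- (2 / m * t)) * M a by ring.
have e2 : C0 * (ja + M a) * expR (- t) = C0 * expR (- t) * (ja + M a) by ring.
rewrite e1 e2; move: vu; rewrite mulrDl mul1r; lra.
Qed.


Lemma J_sym a b : 0 < b -> b <= a -> J a b = J b a.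
Proof.
move=> b0 ba; have a0 : 0 < a := lt_le_trans b0 ba.
have ip : 0 < (mom 0)^-1 by rewrite invr_gt0.
have /mulfI : (mom 0)^-1 != 0 by rewrite gt_eqF.
apply; apply: (J_sym_aux b0 ba).
- exact: mulr_ge0 (ltW ip) (J_ge0 a b0).
- exact: mulr_ge0 (ltW ip) (J_ge0 b a0).
move=> t t0; have d0 := expR_gt0 t.
exists (dint (fun z => Phi b (tau b (expR t)) z * gw a z)),
  (dint (fun z => Phi a (tau a (expR t)) z * gw b z)); split.
- exact: comm0_Phi.
- by apply: dint_Phi_bounds => //; rewrite ltW ?tau_gt0 // tau_le1.
- by apply: dint_Phi_bounds => //; rewrite ltW ?tau_gt0 // tau_le1.
Qed.

(** If the integral vanished, |z| would be 0 almost everywhere and [mom 1] would vanish with it; the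
    positivity of [mom 1] is already known from the kernel. *)
Lemma dint_gt0 (f : pt R -> R) : integ f -> (forall z, 0 <= f z) ->
  (forall z, f z = 0 -> absz z = 0) -> 0 < dint f.
Proof.
move=> fi f0 fz; have d0 : 0 <= dint f by apply: Rintegral_ge0 => z _.
rewrite lt_neqAle d0 andbT eq_sym; apply/eqP => df.
have mf : measurable_fun setT (EFin \o f) by exact: measurable_int fi.
have : (\int[dA]_z `|(EFin \o f) z| = 0)%E.
  under eq_integral do rewrite /= ger0_norm //.
  by rewrite (EFin_dint fi) df.
move=> /(@ae_eq_integral_abs _ _ R dA setT measurableT _ mf) aef.
have : mom 1 = 0.
  rewrite /moment /dint /Rintegral.
  rewrite (@ae_eq_integral _ _ _ dA setT (cst 0%E)) ?integral0 //.
  - by apply: measurable_int (integ_expw m0 _ ltr01).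
  - apply: filterS aef => z h Dz; have /= := h Dz; case=> /fz ->.
    by rewrite expr0n mul0r.
by move=> h; have := momp 1; rewrite h ltxx.
Qed.

Definition kerfunV (z : pt R) : R := (E (q 1 * absz z ^+ 2))^-1.

Lemma kerfunV_gt0 z : 0 < kerfunV z. Proof. by rewrite invr_gt0 Ep // X_ge0. Qed.

(** |z|^n <= 1 + |z|^(2 (n + 1)), and the terms of E of orders 0 and n + 1 bound the two summands by
    [mom 0] and [mom n.+1] times E. *)
Lemma rapid_kerfunV : rapid kerfunV.
Proof.
move=> n; exists (mom 0 + mom n.+1) => z; rewrite gtr0_norm ?kerfunV_gt0 //.
rewrite /kerfunV ler_pdivrMr ?Ep ?X_ge0 //.
have e0 := kerfun_ge m0 hK n (X_ge0 z ltr01).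
have g0 := Ep (X_ge0 z ltr01).
move: e0 g0; rewrite qpow1 mul1r -exprM; set e := E _; set y := _ ^+ (2 * n.+1).
have r0 := absz_ge0 z.
have y0 : 0 <= y by rewrite exprn_ge0.
have rn : absz z ^+ n <= 1 + y.
  have [r1|r1] := leP (absz z) 1.
    by apply: (@le_trans _ _ 1); [exact: exprn_ile1|rewrite lerDl].
  apply: (@le_trans _ _ y); last by rewrite lerDr.
  by apply: ler_weXn2l; [exact: ltW|rewrite (leq_trans (leqnSn n)) // mul2n -addnn leq_addr].
move=> ee e0; apply: le_trans rn _; rewrite mulrDl.
have p0 := momp 0; have p1 := momp n.+1.
apply: lerD.
  rewrite -ler_pdivrMl // mulr1; apply: le_trans ee; rewrite lerDl.
  by apply: divr_ge0 => //; exact: ltW.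
rewrite -ler_pdivrMl // mulrC; apply: le_trans ee; rewrite lerDr invr_ge0 ltW //.
Qed.

Lemma measurable_kerfunV : measurable_fun setT kerfunV. Proof. exact: measurable_kerfun_inv. Qed.

Lemma integ_kerfunV k : integ (fun z => absz z ^+ k * kerfunV z).
Proof.
apply: rapid_integ; last by apply: rapidX; exact: rapid_kerfunV.
apply: measurable_funM; last exact: measurable_kerfunV.
by apply: measurable_funX; exact: measurable_absz.
Qed.

Lemma integ_kerfunV0 : integ kerfunV.
Proof. by apply: eq_integrable (integ_kerfunV 0) => // z _; rewrite /= mul1r. Qed.

Lemma integ_pow_kerfunV : integ (fun z => powR (absz z) m * kerfunV z).
Proof.
pose N := (Num.truncn m).+1.
apply: (integ_le _ (integD integ_kerfunV0 (integ_kerfunV N))) => [|z].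
  by apply: measurable_funM; [exact: measurable_powR_absz|exact: measurable_kerfunV].
have v0 := kerfunV_gt0 z.
rewrite ger0_norm ?mulr_ge0 ?powR_ge0 ?(ltW v0) // -{2}[kerfunV z]mul1r -mulrDl ler_pM2r //.
have r0 := absz_ge0 z.
have [r1|r1] := leP (absz z) 1.
  apply: (@le_trans _ _ 1); last by rewrite lerDl exprn_ge0.
  have -> : 1 = powR 1 m by rewrite powR1.
  by rewrite ge0_ler_powR ?nnegrE // ltW.
apply: (@le_trans _ _ (absz z ^+ N)); last by rewrite lerDr.
rewrite -powR_mulrn // ler_powR ?(ltW r1) // ltW // truncnS_gt //.
Qed.

(** The difference is (E x - E 0) / (E 0 E x). For x <= 1 use E x - E 0 <= x E 1 and E x >= E 0; for
    x > 1 the difference is at most I_0, and I_0 E 1 >= 1. *)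
Lemma mom0_sub_EV x : 0 <= x -> 0 <= mom 0 - (E x)^-1 <= mom 0 ^+ 2 * E 1 * x.
Proof.
move=> x0; have e0 := Ep x0; have p0 := momp 0; have E1 := kerfun_ge_moment0 m0 hK ler01.
have ie : (E x)^-1 <= mom 0.
  by rewrite -[leRHS]invrK lef_pV2 ?posrE ?invr_gt0 // (kerfun_ge_moment0 m0 hK).
rewrite subr_ge0 ie /=.
have ip : mom 0 * (mom 0)^-1 = 1 by rewrite mulfV // gt_eqF.
have C1 : mom 0 <= mom 0 ^+ 2 * E 1.
  rewrite expr2 -mulrA; apply: (@le_trans _ _ (mom 0 * (mom 0 * (mom 0)^-1))).
    by rewrite ip mulr1.
  by rewrite !ler_pM2l.
have [x1|x1] := leP x 1; last first.
  apply: (@le_trans _ _ (mom 0)); first by rewrite gerBl invr_ge0 ltW.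
  apply: le_trans C1 _; rewrite -[leLHS]mulr1; apply: ler_wpM2l; last exact: ltW.
  by rewrite mulr_ge0 ?sqr_ge0 // ltW // Ep.
have x01 : 0 <= x <= 1 by rewrite x0.
have := kerfun_scale_le m0 hK ler01 x01; rewrite mulr1 => es.
have -> : mom 0 - (E x)^-1 = mom 0 * (E x - (mom 0)^-1) * (E x)^-1.
  by field; rewrite !gt_eqF.
have h1 : 0 <= E x - (mom 0)^-1 by rewrite subr_ge0 (kerfun_ge_moment0 m0 hK).
have h2 : E x - (mom 0)^-1 <= x * E 1.
  rewrite lerBlDl; apply: le_trans es _; rewrite lerD2l ler_wpM2l // gerBl invr_ge0 ltW //.
apply: (@le_trans _ _ (mom 0 * (E x - (mom 0)^-1) * mom 0)).
  by apply: ler_wpM2l => //; rewrite mulr_ge0 // ltW.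
have -> : mom 0 ^+ 2 * E 1 * x = mom 0 * (x * E 1) * mom 0 by ring.
by rewrite ler_pM2r // ler_pM2l.
Qed.

(** The linear term of E gives the bound, and E y in place of E x makes it exactly linear in x. It
    is applied with x = eps^s |z|^2 and y = |z|^2, so that eps^s factors out of the integral. *)
Lemma mom0_sub_EV_ge x y : 0 <= x -> x <= y ->
  mom 0 / mom 1 * x * (E y)^-1 <= mom 0 - (E x)^-1.
Proof.
move=> x0 xy; have y0 := le_trans x0 xy.
have := kerfun_ge m0 hK 0 x0; rewrite expr1.
have := kerfun_mono m0 hK x0 xy; have := Ep x0; have := Ep y0; have := momp 0; have := momp 1.
move: (E x) (E y) (mom 0) (mom 1) => e f p r r0 p0 f0 e0 ef ee.
have -> : p - e^-1 = p * (e - p^-1) / e by field; rewrite !gt_eqF.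
apply: ler_pM.
- by rewrite mulr_ge0 // divr_ge0 // ltW.
- by rewrite invr_ge0 ltW.
- by rewrite mulrAC -mulrA ler_pM2l //; move: ee; lra.
- by rewrite lef_pV2 ?posrE.
Qed.

Lemma comm0_eq2 : m = 2.
Proof.
have s0 : 0 < 2 / m by rewrite divr_gt0.
pose s := 2 / m; rewrite -/s in s0.
(* Q0 and P0 are the limits of J(eps, 1) and J(1, eps) as eps -> 0. The distance to Q0 lies between
   eps A1 and eps B1, the distance to P0 between eps^s A2 and eps^s B2. *)
pose Q0 := dint kerfunV; pose P0 := dint (fun z => mom 0 * gw 1 z).
pose A1 := dint (fun z => (1 - gw 1 z) * kerfunV z).
pose B1 := dint (fun z => powR (absz z) m * kerfunV z).
pose A2 := dint (fun z => mom 0 / mom 1 * (absz z ^+ 2 * kerfunV z * gw 1 z)).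
pose B2 := dint (fun z => mom 0 ^+ 2 * E 1 * (absz z ^+ 2 * gw 1 z)).
have gw_le1 a z : 0 < a -> gw a z <= 1.
  by move=> a0; rewrite /expw -expR0 ler_expR oppr_le0 mulr_ge0 ?powR_ge0 // ltW.
have i1 : integ (fun z => (1 - gw 1 z) * kerfunV z).
  apply: (integ_le _ integ_kerfunV0) => [|z].
    apply: measurable_funM; last exact: measurable_kerfunV.
    by apply: measurable_funB => //; exact: measurable_expw.
  have g1 := gw_le1 1 z ltr01; have g0 := gwp 1 z; have v0 := kerfunV_gt0 z.
  rewrite ger0_norm; last by rewrite mulr_ge0 ?subr_ge0 // ltW.
  by rewrite -[leRHS]mul1r ler_pM2r // gerBl ltW.
have i2 : integ (fun z => absz z ^+ 2 * kerfunV z * gw 1 z).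
  apply: (integ_le _ (integ_kerfunV 2)) => [|z].
    apply: measurable_funM; last exact: measurable_expw.
    apply: measurable_funM; last exact: measurable_kerfunV.
    by apply: measurable_funX; exact: measurable_absz.
  have g1 := gw_le1 1 z ltr01; have g0 := gwp 1 z; have v0 := kerfunV_gt0 z.
  have p0 : 0 <= absz z ^+ 2 * kerfunV z by rewrite mulr_ge0 ?sqr_ge0 // ltW.
  rewrite ger0_norm; last by rewrite mulr_ge0 // ltW.
  by rewrite -[leRHS]mulr1 ler_wpM2l.
have A1p : 0 < A1.
  apply: dint_gt0 => // [z|z /eqP].
    by rewrite mulr_ge0 ?subr_ge0 ?gw_le1 // ltW // kerfunV_gt0.
  rewrite mulf_eq0 (gt_eqF (kerfunV_gt0 z)) orbF subr_eq0 => /eqP h.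
  have /expR_inj/eqP : expR (- (1 * powR (absz z) m)) = expR 0.
    by rewrite expR0; exact: esym h.
  by rewrite mul1r oppr_eq0 powR_eq0 (gt_eqF m0) andbT => /eqP.
have A2p : 0 < A2.
  apply: dint_gt0 => [|z|z /eqP].
  - exact: integZ.
  - have v0 := kerfunV_gt0 z; have g0 := gwp 1 z; have p0 := momp 0; have p1 := momp 1.
    by apply: mulr_ge0; [apply: divr_ge0|apply: mulr_ge0; [apply: mulr_ge0; [exact: sqr_ge0|]|]];
      exact: ltW.
  - have v0 := kerfunV_gt0 z; have g0 := gwp 1 z; have p0 := momp 0; have p1 := momp 1.
    rewrite mulf_eq0 (gt_eqF (divr_gt0 p0 p1)) /= mulf_eq0 (gt_eqF g0) orbF mulf_eq0.
    by rewrite (gt_eqF v0) orbF sqrf_eq0 => /eqP.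
have B1p : 0 <= B1.
  by apply: Rintegral_ge0 => z _; rewrite mulr_ge0 ?powR_ge0 // ltW // kerfunV_gt0.
have B2p : 0 <= B2.
  apply: Rintegral_ge0 => z _; have g0 := gwp 1 z; have E1 := Ep ler01.
  by apply: mulr_ge0; apply: mulr_ge0; rewrite ?sqr_ge0 //; exact: ltW.
have main t : 0 <= t -> exists j,
    expR (- t) * A1 <= Q0 - j <= expR (- t) * B1 /\
    expR (- (s * t)) * A2 <= P0 - j <= expR (- (s * t)) * B2.
  move=> t0; pose e := expR (- t); rewrite -/e; have e0 : 0 < e by exact: expR_gt0.
  have e1 : e <= 1 by rewrite /e -expR0 ler_expR oppr_le0.
  have e01 : 0 <= e <= 1 by rewrite ltW.
  have qe : q e = expR (- (s * t)) by rewrite qpow_expR mulrN.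
  exists (J e 1); split.
    have iJ := integ_J e0 ltr01.
    rewrite /Q0 /J -dintB //; last exact: integ_kerfunV0.
    have eqf : (fun z => kerfunV z - gw e z / E (q 1 * absz z ^+ 2)) =1 (fun z => (1 - gw e z) * kerfunV z).
      by move=> z; rewrite mulrBl mul1r.
    have iB : integ (fun z => kerfunV z - gw e z / E (q 1 * absz z ^+ 2)).
      by apply: integB => //; exact: integ_kerfunV0.
    rewrite /A1 /B1 -!dintZ //; last exact: integ_pow_kerfunV.
    apply/andP; split; apply: dint_le => //; do ?exact: integZ.
    (* Convexity: 1 - exp (- e x) >= e (1 - exp (- x)). *)
    - move=> z; rewrite eqf mulrA ler_pM2r ?kerfunV_gt0 //.
      have := exp_convex (powR (absz z) m) e01; rewrite /expw mul1r; lra.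
    - by apply: integZ; exact: integ_pow_kerfunV.
    - move=> z; rewrite eqf mulrA ler_pM2r ?kerfunV_gt0 // /expw.
      by have := expR_ge1Dx (- (e * powR (absz z) m)); lra.
  rewrite -(J_sym e0 e1).
  have iJ := integ_J ltr01 e0.
  have ig := integZ (mom 0) (integ_expw0 ltr01).
  rewrite /P0 /J -dintB // -qe.
  have eqf : (fun z => mom 0 * gw 1 z - gw 1 z / E (q e * absz z ^+ 2)) =1
      (fun z => (mom 0 - (E (q e * absz z ^+ 2))^-1) * gw 1 z).
    by move=> z; ring.
  have iB := integB ig iJ.
  have i3 : integ (fun z => absz z ^+ 2 * gw 1 z) by exact: integ_expw.
  rewrite /A2 /B2 -!dintZ //; do ?exact: integZ.
  apply/andP; split; apply: dint_le => //; do ?[exact: integZ|by apply: integZ; exact: integZ].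
  - move=> z; rewrite eqf.
    have X0 := X_ge0 z e0; have X1 := X_ge0 z ltr01.
    have g0 := gwp 1 z.
    have -> : q e * (mom 0 / mom 1 * (absz z ^+ 2 * kerfunV z * gw 1 z)) =
      mom 0 / mom 1 * (q e * absz z ^+ 2) * kerfunV z * gw 1 z by ring.
    rewrite ler_pM2r //.
    apply: mom0_sub_EV_ge => //.
    by rewrite ler_wpM2r ?sqr_ge0 // qpow_mono.
  - move=> z; rewrite eqf [leRHS](_ : _ =
      mom 0 ^+ 2 * E 1 * (q e * absz z ^+ 2) * gw 1 z); last by ring.
    rewrite ler_pM2r; last exact: gwp.
    by have /andP[_] := mom0_sub_EV (X_ge0 z e0).
have D1 : Q0 - P0 <= 0.
  apply: (@exp_small _ _ B1 0 s) => // t t0; have [j [/andP[a1 a2] /andP[b1 b2]]] := main t t0.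
  have := mulr_ge0 (expR_ge0 (- (s * t))) (ltW A2p).
  by rewrite mul0r addr0 [B1 * _]mulrC; lra.
have D2 : P0 - Q0 <= 0.
  apply: (@exp_small _ _ 0 B2 s) => // t t0; have [j [/andP[a1 a2] /andP[b1 b2]]] := main t t0.
  have := mulr_ge0 (expR_ge0 (- t)) (ltW A1p).
  by rewrite mul0r add0r [B2 * _]mulrC; lra.
have QP : Q0 = P0 by lra.
(* With equal limits both pairs of bounds concern the same difference. If s > 1 then A1 <= B2 exp (-
   (s - 1) t), if s < 1 then A2 <= B1 exp (- (1 - s) t), for all t >= 0; either contradicts A1, A2 >
   0. *)
suff s1 : s = 1.
  have : s * m = 2 by rewrite /s divfK // gt_eqF.
  by rewrite s1 mul1r.
apply/eqP; rewrite eq_le !leNgt; apply/andP; split; apply/negP => s1.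
- suff : A1 <= 0 by rewrite leNgt A1p.
  apply: (@exp_small _ _ 0 B2 (s - 1)) => //; first by rewrite subr_gt0.
  move=> t t0; have [j [/andP[a1 a2] /andP[b1 b2]]] := main t t0.
  have h : expR (- t) * A1 <= expR (- (s * t)) * B2 by lra.
  rewrite mul0r add0r (_ : - ((s - 1) * t) = - (s * t) - (- t)); last by ring.
  by rewrite expRB mulrA ler_pdivlMr ?expR_gt0 // mulrC [B2 * _]mulrC.
- suff : A2 <= 0 by rewrite leNgt A2p.
  apply: (@exp_small _ _ 0 B1 (1 - s)) => //; first by rewrite subr_gt0.
  move=> t t0; have [j [/andP[a1 a2] /andP[b1 b2]]] := main t t0.
  have h : expR (- (s * t)) * A2 <= expR (- t) * B1 by lra.
  rewrite mul0r add0r (_ : - ((1 - s) * t) = - t - (- (s * t))); last by ring.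
  by rewrite expRB mulrA ler_pdivlMr ?expR_gt0 // mulrC [B1 * _]mulrC.
Qed.

End commutation.

(** * The Gaussian case *)

Section exponential_series.

(** Over an arbitrary numeric field, because the identities are applied both to complex arguments
    and to their moduli. *)
Definition expsum (F : numFieldType) (x : F) N := \sum_(n < N) x ^+ n / n`!%:R.

Lemma sum_triangle (V : nmodType) (f : nat -> nat -> V) N :
  \sum_(n < N) \sum_(j < n.+1) f j (n - j)%N = \sum_(j < N) \sum_(k < N - j) f j k.
Proof.
elim: N => [|N IH]; first by rewrite !big_ord0.
rewrite big_ord_recr /= IH [in RHS]big_ord_recr /= subSnn big_ord1.
rewrite [X in _ + X]big_ord_recr /= subnn addrA; congr (_ + _).
rewrite -big_split; apply: eq_bigr => j _ /=.
by rewrite subSn ?big_ord_recr // ltnW.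
Qed.

Lemma expsumD (F : numFieldType) (x y : F) N :
  expsum (x + y) N =
  \sum_(j < N) \sum_(k < N - j) x ^+ j / j`!%:R * (y ^+ k / k`!%:R).
Proof.
rewrite -(sum_triangle (fun j k => x ^+ j / j`!%:R * (y ^+ k / k`!%:R))).
apply: eq_bigr => n _; rewrite addrC exprDn mulr_suml; apply: eq_bigr => j _.
have jn : (j <= n)%N by rewrite -ltnS.
have f0 k : k`!%:R != 0 :> F.
  by rewrite pnatr_eq0 -lt0n fact_gt0.
have := bin_fact jn => /(congr1 (fun k => k%:R : F)); rewrite !natrM => <-.
rewrite -mulr_natr; field.
have : 'C(n, j)%:R != 0 :> F by rewrite pnatr_eq0 -lt0n bin_gt0.
by move=> ->; rewrite !f0.
Qed.

(** The product runs over the square j, k < N and [expsum (x + y)] over the triangle j + k < N; the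
    rest of the square remains. *)
Lemma expsumM_sub (F : numFieldType) (x y : F) N :
  expsum x N * expsum y N - expsum (x + y) N =
  \sum_(j < N) \sum_(N - j <= k < N) x ^+ j / j`!%:R * (y ^+ k / k`!%:R).
Proof.
rewrite expsumD /expsum mulr_suml -sumrB; apply: eq_bigr => j _.
rewrite mulr_sumr -(big_mkord xpredT (fun k => x ^+ j / j`!%:R * (y ^+ k / k`!%:R))).
rewrite -(big_mkord xpredT (fun k => x ^+ j / j`!%:R * (y ^+ k / k`!%:R))).
by rewrite (big_cat_nat (leq0n (N - j)) (leq_subr j N)) /= addrAC subrr add0r.
Qed.

Variable R : realType.

Lemma expsum_cvg (x : R) : expsum x @ \oo --> expR x.
Proof.
have := is_cvg_series_exp_coeff x.
rewrite (_ : expsum x = series (exp_coeff x)) //.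
by apply/funext => N; rewrite /series /= big_mkord.
Qed.

(* The error in S_N(x) S_N(y) = S_N(x + y) is dominated by the same error at
   |x| and |y|, where it vanishes in the limit by the real exponential law. *)
Lemma expsumM_sub_norm (x y : R[i]) N :
  normc (expsum x N * expsum y N - expsum (x + y) N) <=
  expsum (normc x) N * expsum (normc y) N - expsum (normc x + normc y) N.
Proof.
rewrite !expsumM_sub; apply: le_trans (normc_sum _ _) _; apply: ler_sum => j _.
apply: le_trans (normc_sum _ _) _; apply: ler_sum => k _.
rewrite !Normc.normcM !Normc.normcV !normcX.
have e n : normc (n%:R : R[i]) = n%:R.
  by rewrite -(rmorph_nat (real_complex R)) normc_real ger0_norm.
by rewrite !e.
Qed.

(** |exp x|^2 = exp x exp (conj x) = exp (x + conj x), carried out on partial sums; sine and cosine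
    do not appear. *)
Lemma normc_exp (x l : R[i]) : ccvg (expsum x) l -> normc l ^+ 2 = expR (2 * cRe x).
Proof.
move=> cx.
have c1 : (fun N => cRe (expsum x N * conjc (expsum x N))) @ \oo --> normc l ^+ 2.
  by have [h _] := ccvgM cx (ccvgJ cx); move: h; rewrite mulcJ.
have c2 : (fun N => cRe (expsum x N * conjc (expsum x N))) @ \oo --> expR (2 * cRe x).
  have cz : (fun N => expsum (normc x) N * expsum (normc x) N - expsum (normc x + normc x) N)
      @ \oo --> (0 : R).
    rewrite (_ : 0 = expR (normc x) * expR (normc x) - expR (normc x + normc x)).
      by apply: cvgB; [apply: cvgM|]; exact: expsum_cvg.
    by rewrite expRD subrr.
  have cd : (fun N => cRe (expsum x N * conjc (expsum x N)) - expsum (2 * cRe x) N)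
      @ \oo --> (0 : R).
    apply: (squeeze_cvgr _ _ cz); last by rewrite -oppr0; exact: cvgN cz.
    apply: nearW => N; rewrite /= -ler_norml.
    have -> : cRe (expsum x N * conjc (expsum x N)) - expsum (2 * cRe x) N =
        cRe (expsum x N * expsum (conjc x) N - expsum (x + conjc x) N).
      have -> : conjc (expsum x N) = expsum (conjc x) N.
        rewrite /expsum rmorph_sum; apply: eq_bigr => n _.
        by rewrite rmorphM fmorphV rmorphXn rmorph_nat.
      have -> : x + conjc x = (2 * cRe x)%:C%C.
        by apply: complex_ext; rewrite ?cReD ?cImD ?cReJ ?cImJ /=; ring.
      rewrite cReD cReN; congr (_ - _).
      have -> : expsum (2 * cRe x)%:C%C N = (expsum (2 * cRe x) N)%:C%C :> R[i].
        rewrite /expsum rmorph_sum; apply: eq_bigr => n _.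
        by rewrite -rmorphXn -(rmorph_nat (real_complex R)) -fmorphV -rmorphM.
      by [].
    apply: le_trans (cRe_le_normc _) _; rewrite -{2 4}(normc_conjc x).
    exact: expsumM_sub_norm.
  rewrite -[X in _ --> X]add0r.
  rewrite (_ : (fun N => _) = fun N => (cRe (expsum x N * conjc (expsum x N)) -
     expsum (2 * cRe x) N) + expsum (2 * cRe x) N).
    by apply: cvgD => //; exact: expsum_cvg.
  by apply/funext => N; rewrite subrK.
exact: cvg_unique c1 c2.
Qed.

End exponential_series.

(** Squares exhaust the plane. Fubini on the product of two planes takes the area measure as a
    factor and asks for this. *)
Lemma sigma_finite_dA (R : realType) : sigma_finite setT (@dA R).
Proof.
pose F n : set R := `[- n%:R, n%:R]%classic.
exists (fun n => F n `*` F n).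
  apply/seteqP; split => // -[x y] _; exists (Num.truncn (`|x| + `|y|)).+1 => //.
  have h := ltW (truncnS_gt (`|x| + `|y|)).
  split; rewrite /F /= in_itv /= -ler_norml; apply: le_trans h.
    by rewrite lerDl.
  by rewrite lerDr.
have mF n : measurable (F n : set (measurableTypeR R)) by exact: measurable_itv.
have foo n : (lebesgue_measure (F n : set (measurableTypeR R)) < +oo)%E.
  by rewrite /F /= lebesgue_measure_itv /=; case: ifP => _; rewrite -?EFinB ltry.
move=> n; split; first exact: measurableX.
rewrite /dA product_measure1E //; apply: lte_mul_pinfty; [exact: measure_ge0| |exact: foo].
by rewrite ge0_fin_numE; [exact: foo|exact: measure_ge0].
Qed.

HB.instance Definition _ (R : realType) := Measure.on (@dA R).
HB.instance Definition _ (R : realType) :=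
  Measure_isSigmaFinite.Build _ _ _ (@dA R) (@sigma_finite_dA R).

(** * Factorial moments and Gaussian convolutions for m = 2 *)

Section gaussian.
Variable R : realType.
Local Notation dA := (@dA R).
Local Notation integ f := (dA.-integrable setT (EFin \o f)).
Variable K : R -> pt R -> pt R -> R[i].
Hypothesis hK : forall a, 0 < a -> reproducing_kernel a 2 (K a).
Local Notation mom := (moment (2 : R)).
Local Notation kappa := (dens_cst (2 : R)).
Let two0 : 0 < 2 :> R. Proof. by []. Qed.
Let momp n : 0 < mom n. Proof. exact: (moment_gt0 two0 hK n). Qed.
Let kp : 0 < kappa. Proof. exact: (dens_cst_gt0 two0 hK). Qed.

Lemma qpow2 (a : R) : 0 <= a -> qpow 2 a = a.
Proof. by move=> a0; rewrite /qpow divff // powRr1. Qed.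

Lemma expw2 (a : R) z : expw 2 a z = expR (- (a * absz z ^+ 2)).
Proof. by rewrite /expw powR_mulrn // absz_ge0. Qed.

Lemma le_pow_squeeze (a b : R) N : 0 <= a ->
  (forall c, 1 < c -> a <= c ^+ N * b) -> a <= b.
Proof.
move=> a0 h; rewrite leNgt; apply/negP => ba.
have [a1|a1] := eqVneq a 0.
  have := h 2; rewrite ltr1n => /(_ isT); rewrite a1 pmulr_rge0 ?exprn_gt0 //.
  by rewrite leNgt -a1 ba.
have {a1}a0 : 0 < a by rewrite lt_neqAle eq_sym a1.
(* With c = exp u the hypothesis gives a (1 - N u) <= b, whereas N u a < (a - b) / 2 by the choice
   of u. *)
pose u := (a - b) / (2 * N.+1%:R * a).
have u0 : 0 < u by rewrite divr_gt0 ?subr_gt0 // !mulr_gt0.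
have := h (expR u); rewrite expR_gt1 => /(_ u0).
rewrite -expRM_natl -ler_pdivrMl ?expR_gt0 // -expRN => hb.
have := ler_wpM2r (ltW a0) (expR_ge1Dx (- (N%:R * u))).
have e : N.+1%:R * u * a = (a - b) / 2.
  have : N.+1%:R != 0 :> R by rewrite pnatr_eq0.
  by rewrite /u; move: (N.+1%:R : R) => k k0; field; rewrite k0 gt_eqF.
have ua : 0 < u * a by rewrite mulr_gt0.
move: e; rewrite -natr1; lra.
Qed.

(** In place of an integration by parts: the integral of |z|^(2 n) exp (- c |z|^2) is c^-(n + 1) I_n
    by scaling, and the two sides of the recursion are its derivative at c = 1 up to sign.
    Tangent-line bounds for exp enclose the difference quotient for c > 1, and [le_pow_squeeze] lets
    c tend to 1. *)
Lemma moment_succ n : mom n.+1 = n.+1%:R * mom n.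
Proof.
have i1 c k : 0 < c -> integ (fun z => absz z ^+ (2 * k) * expw 2 c z).
  by move=> c0; exact: integ_expw.
have sc c k : 0 < c -> dint (fun z => absz z ^+ (2 * k) * expw 2 c z) = c ^- k.+1 * mom k.
  by move=> c0; rewrite moment_scale // qpow2 // ltW.
have bnd c : 1 < c -> (c - 1) * (c ^- n.+2 * mom n.+1) <= mom n - c ^- n.+1 * mom n
    <= (c - 1) * mom n.+1.
  move=> c1; have c0 : 0 < c by exact: lt_trans c1.
  have <- : dint (fun z => absz z ^+ (2 * n) * expw 2 1 z - absz z ^+ (2 * n) * expw 2 c z) =
      mom n - c ^- n.+1 * mom n.
    by rewrite dintB; [rewrite (sc c n c0)|exact: i1|exact: i1].
  rewrite -sc // -!dintZ; [|exact: i1|exact: i1].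
  have xE z : absz z ^+ (2 * n.+1) = absz z ^+ (2 * n) * absz z ^+ 2 :> R.
    by rewrite mulnS addnC exprD.
  have iB : integ (fun z => absz z ^+ (2 * n) * expw 2 1 z - absz z ^+ (2 * n) * expw 2 c z).
    by apply: integB; exact: i1.
  apply/andP; split; apply: dint_le => //; do ?by apply: integZ; exact: i1.
    move=> z; rewrite xE !expw2 mul1r; have := exprn_ge0 (2 * n) (absz_ge0 z).
    move: (absz z ^+ (2 * n)) (absz z ^+ 2) => p x p0.
    rewrite -mulrBr -[p * x * _]mulrA [(c - 1) * _]mulrCA; apply: ler_wpM2l => //.
     set y := expR (- (c * x)); have y0 : 0 < y by exact: expR_gt0.
    have -> : expR (- x) = y * expR ((c - 1) * x) by rewrite -expRD; congr expR; ring.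
    by have := ler_wpM2l (ltW y0) (expR_ge1Dx ((c - 1) * x)); lra.
  move=> z; rewrite xE !expw2 mul1r; have := exprn_ge0 (2 * n) (absz_ge0 z).
  move: (absz z ^+ (2 * n)) (absz z ^+ 2) => p x p0.
  rewrite -mulrBr -[p * x * _]mulrA [(c - 1) * _]mulrCA; apply: ler_wpM2l => //.
   set y := expR (- x); have y0 : 0 < y by exact: expR_gt0.
  have -> : expR (- (c * x)) = y * expR (- ((c - 1) * x)) by rewrite -expRD; congr expR; ring.
  by have := ler_wpM2l (ltW y0) (expR_ge1Dx (- ((c - 1) * x))); lra.
have m0 := momp n; have m1 := momp n.+1.
(* s is the geometric sum (c^(n + 1) - 1) / (c - 1). *)
have S (c : R) : 1 < c -> exists2 s, (c ^+ n.+1 - 1 = (c - 1) * s) & n.+1%:R <= s <= n.+1%:R * c ^+ n.+1.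
  move=> c1; exists (\sum_(i < n.+1) c ^+ i); first exact: subrX1.
  have -> : n.+1%:R = \sum_(i < n.+1) (1 : R) by rewrite sumr_const card_ord.
  rewrite mulr_suml; apply/andP; split; apply: ler_sum => i _.
    by rewrite exprn_ege1 // ltW.
  by rewrite mul1r; apply: ler_weXn2l; [exact: ltW|apply: ltnW].
apply/eqP; rewrite eq_le; apply/andP; split.
  apply: (@le_pow_squeeze _ _ n.+2); first exact: ltW.
  move=> c c1; have c0 : 0 < c by exact: lt_trans c1.
  have /andP[h _] := bnd c c1; have [s es /andP[s1 s2]] := S c c1.
  have cn : 0 < c ^+ n.+1 by rewrite exprn_gt0.
  have c10 : 0 < c - 1 by rewrite subr_gt0.
  have e : mom n - c ^- n.+1 * mom n = (c - 1) * (c ^- n.+2 * (c * s * mom n)).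
    transitivity (c ^- n.+1 * ((c ^+ n.+1 - 1) * mom n)); first by field; rewrite gt_eqF.
    by rewrite es [c ^+ n.+2]exprS; field; rewrite !gt_eqF.
  move: h; rewrite e !ler_pM2l ?invr_gt0 ?exprn_gt0 // => /le_trans; apply.
  rewrite mulrA ler_pM2r // exprS -mulrA ler_pM2l // mulrC //.
apply: (@le_pow_squeeze _ _ n.+1); first by rewrite mulr_ge0 // ltW.
move=> c c1; have c0 : 0 < c by exact: lt_trans c1.
have /andP[_ h] := bnd c c1; have [s es /andP[s1 s2]] := S c c1.
have cn : 0 < c ^+ n.+1 by rewrite exprn_gt0.
have c10 : 0 < c - 1 by rewrite subr_gt0.
apply: (@le_trans _ _ (s * mom n)); first by rewrite ler_pM2r.
rewrite -(ler_pM2l c10); have := ler_wpM2l (ltW cn) h.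
have -> : c ^+ n.+1 * (mom n - c ^- n.+1 * mom n) = (c - 1) * (s * mom n).
  by rewrite mulrA -es; field; rewrite gt_eqF.
by rewrite (mulrCA (c ^+ n.+1)).
Qed.

Lemma moment_fact n : mom n = n`!%:R * mom 0.
Proof.
elim: n => [|n IH]; first by rewrite fact0 mul1r.
by rewrite moment_succ IH factS natrM mulrA.
Qed.

Lemma kerfun2 x : kerfun 2 x = expR x / mom 0.
Proof.
apply: cvg_lim => //.
rewrite (_ : kerfun_sum 2 x = fun N => expsum x N / mom 0).
  by apply: cvgMl; exact: expsum_cvg.
apply/funext => N; rewrite /expsum mulr_suml; apply: eq_bigr => n _.
by rewrite moment_fact invfM mulrA.
Qed.

Lemma normc_kernel a w z : 0 < a ->
  normc (K a w z) ^+ 2 =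
  (kappa * mom 0) ^- 2 * expR (2 * (a * (w.1 * z.1 + w.2 * z.2))).
Proof.
move=> a0; pose x : R[i] := a%:C%C * (toC w * conjc (toC z)).
have k0 : kappa * mom 0 != 0 by rewrite gt_eqF // mulr_gt0.
have cx : ccvg (expsum x) ((kappa * mom 0)%:C%C * K a w z).
  have := ccvgM (ccvg_cst (kappa * mom 0)%:C%C) (kernel_cvg two0 hK w z a0).
  rewrite (qpow2 (ltW a0)) -/x; congr (ccvg _ _); apply/funext => N.
  rewrite mulrA -rmorphM /psum mulr_sumr; apply: eq_bigr => n _.
  rewrite mulrA -rmorphM /= mulrC; congr (_ * _).
  rewrite (moment_fact n) -(rmorph_nat (real_complex R)) -fmorphV; congr (_%:C)%C.
  by field; rewrite !gt_eqF // ltr0n fact_gt0.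
have xE : cRe x = a * (w.1 * z.1 + w.2 * z.2) by rewrite /x !cReM /=; ring.
have := normc_exp cx; rewrite xE.
move: (kappa * mom 0) k0 => k k0.
by rewrite Normc.normcM normc_real exprMn real_normK ?num_real // => <-; field.
Qed.

Definition psub (v w : pt R) : pt R := (v.1 - w.1, v.2 - w.2).
Definition gauss (a : R) (v : pt R) : R := a / mom 0 * expR (- (a * absz v ^+ 2)).

(** Completing the square: 2 a Re (w conj z) - a |z|^2 - a |w|^2 = - a |w - z|^2. *)
Lemma berezin_gauss a f z : 0 < a ->
  berezin a 2 (K a) f z = CI (fun w => f w * (gauss a (psub w z))%:C%C).
Proof.
move=> a0; rewrite /berezin cintE; apply: eq_CI => w.
have cC (x : R[i]) (A B D : R) :
    x * A%:C%C / B%:C%C * D%:C%C = x * (A / B * D)%:C%C.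
  by rewrite !rmorphM fmorphV !mulrA.
rewrite (kernel_diag two0 hK z a0) (qpow2 (ltW a0)) kerfun2 normc_kernel // cC.
congr (_ * _%:C)%C; rewrite densE -/(qpow 2 a) (qpow2 (ltW a0)) expw2 /gauss.
have -> : expR (- (a * absz (psub w z) ^+ 2)) =
   expR (2 * (a * (w.1 * z.1 + w.2 * z.2))) * (expR (a * absz z ^+ 2))^-1 * expR (- (a * absz w ^+ 2)).
  by rewrite -expRN -!expRD !absz_sqr /psub /=; congr expR; ring.
have := expR_gt0 (a * absz z ^+ 2); move: (expR (a * absz z ^+ 2)) => y y0.
have := kp; have := momp 0; move: kappa (mom 0) => k p p0 k0.
by field; rewrite !gt_eqF.
Qed.

Lemma gauss_gt0 a v : 0 < a -> 0 < gauss a v.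
Proof. by move=> a0; rewrite !mulr_gt0 ?invr_gt0 ?expR_gt0. Qed.

Lemma gauss_sym a v w : gauss a (psub v w) = gauss a (psub w v).
Proof. by rewrite /gauss !absz_sqr /psub /=; congr (_ * expR _); ring. Qed.

Lemma measurable_gauss a : measurable_fun setT (gauss a).
Proof.
apply: measurable_funM => //; apply: measurableT_comp => //.
apply: measurable_funN; apply: measurable_funM => //.
by apply: measurable_funX; exact: measurable_absz.
Qed.

Lemma measurable_psub d (T : measurableType d) (u v : T -> pt R) :
  measurable_fun setT u -> measurable_fun setT v ->
  measurable_fun setT (fun t => psub (u t) (v t)).
Proof.
move=> mu mv; apply/measurable_fun_pair => /=; apply: measurable_funB.
- exact: (measurableT_comp measurable_fst mu).
- exact: (measurableT_comp measurable_fst mv).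
- exact: (measurableT_comp measurable_snd mu).
- exact: (measurableT_comp measurable_snd mv).
Qed.

Lemma measurable_gauss_psub a z : measurable_fun setT (fun w => gauss a (psub w z)).
Proof.
by apply: (measurableT_comp (measurable_gauss a)); exact: measurable_psub.
Qed.

Lemma integ_gauss a : 0 < a -> integ (gauss a).
Proof.
move=> a0; apply: eq_integrable (integZ (a / mom 0) (integ_expw0 two0 a0)) => // z _.
by rewrite /= expw2.
Qed.

Lemma integral_gauss_psub a z : 0 < a -> (\int[dA]_w (gauss a (psub w z))%:E = (dint (gauss a))%:E)%E.
Proof.
move=> a0; rewrite -(EFin_dint (integ_gauss a0)).
rewrite -(@ge0_dA_reflect R (fun w => (gauss a w)%:E) z).
- by apply: eq_integral => w _; rewrite gauss_sym.
- by apply/measurable_EFinP; exact: measurable_gauss.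
- by move=> w; rewrite lee_fin ltW // gauss_gt0.
Qed.

Lemma integ_gauss_psub a z : 0 < a -> integ (fun w => gauss a (psub w z)).
Proof.
move=> a0; apply/integrableP; split.
  by apply/measurable_EFinP; exact: measurable_gauss_psub.
under eq_integral do rewrite /= gtr0_norm ?gauss_gt0 //.
by rewrite integral_gauss_psub // ltry.
Qed.

Definition conv a (g : pt R -> R) z := dint (fun w => g w * gauss a (psub w z)).

Lemma berezin_conv a f : 0 < a -> berezin a 2 (K a) f =
  fun z => (conv a (fun w => cRe (f w)) z +i* conv a (fun w => cIm (f w)) z)%C.
Proof.
move=> a0; apply/funext => z; rewrite berezin_gauss //; apply: complex_ext => /=.
  by apply: eq_dint => w; rewrite cReMr.
by apply: eq_dint => w; rewrite cImMr.
Qed.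

Section convolution.
Variables (g : pt R -> R) (M : R).
Hypothesis mg : measurable_fun setT g.
Hypothesis gM : forall z, `|g z| <= M.

Lemma integ_conv b w : 0 < b -> integ (fun v => g v * gauss b (psub v w)).
Proof.
move=> b0; apply: (integ_le _ (integZ M (integ_gauss_psub w b0))) => [|v].
  by apply: measurable_funM => //; exact: measurable_gauss_psub.
by rewrite normrM (gtr0_norm (gauss_gt0 _ b0)) ler_wpM2r // ltW // gauss_gt0.
Qed.

Lemma integ_gauss_gauss a b v z : 0 < a -> 0 < b ->
  integ (fun w => gauss b (psub v w) * gauss a (psub w z)).
Proof.
move=> a0 b0; apply: (integ_le _ (integZ (b / mom 0) (integ_gauss_psub z a0))) => [|w].
  apply: measurable_funM; last exact: measurable_gauss_psub.
  by apply: (measurableT_comp (measurable_gauss b)); exact: measurable_psub.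
have ga := gauss_gt0 (psub w z) a0; have gb := gauss_gt0 (psub v w) b0.
rewrite (gtr0_norm (mulr_gt0 gb ga)) (ler_pM2r ga).
rewrite /gauss -[leRHS]mulr1 ler_pM2l ?divr_gt0 // -expR0 ler_expR oppr_le0.
by rewrite mulr_ge0 ?sqr_ge0 // ltW.
Qed.

(** Fubini. Absolute integrability holds because |g| <= M bounds the inner integral by M times the
    mass of [gauss b] times [gauss a (psub w z)]. *)
Lemma conv_conv a b z : 0 < a -> 0 < b ->
  conv a (conv b g) z = dint (fun v => g v * dint (fun w => gauss b (psub v w) * gauss a (psub w z))).
Proof.
move=> a0 b0.
pose H (p : pt R * pt R) : R := g p.2 * gauss b (psub p.2 p.1) * gauss a (psub p.1 z).
have mH : measurable_fun setT H.
  apply: measurable_funM; first apply: measurable_funM.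
  - exact: (measurableT_comp mg measurable_snd).
  - by apply: (measurableT_comp (measurable_gauss b)); exact: measurable_psub.
  - exact: (measurableT_comp (measurable_gauss_psub a z) measurable_fst).
have mHE : measurable_fun setT (EFin \o H) by exact/measurable_EFinP.
have i1 w : integ (fun v => H (w, v)).
  apply: eq_integrable (integZ (gauss a (psub w z)) (integ_conv w b0)) => // v _.
  by rewrite /= /H /= mulrC.
have i2 v : integ (fun w => H (w, v)).
  apply: eq_integrable (integZ (g v) (integ_gauss_gauss v z a0 b0)) => // w _.
  by rewrite /= /H /= mulrA.
have M0 : 0 <= M by exact: le_trans (gM z).
have dG w : dint (fun v => gauss b (psub v w)) = dint (gauss b).
  by rewrite /dint /Rintegral integral_gauss_psub.
have bd w : (\int[dA]_v `|(EFin \o H) (w, v)| <= (M * dint (gauss b) * gauss a (psub w z))%:E)%E.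
  have iw := integZ (M * gauss a (psub w z)) (integ_gauss_psub w b0).
  rewrite (_ : M * _ * _ = dint (fun v => M * gauss a (psub w z) * gauss b (psub v w))); last first.
    by rewrite (dintZ _ (integ_gauss_psub w b0)) dG; ring.
  rewrite -(EFin_dint iw); apply: ge0_le_integral.
  - exact: measurableT.
  - by move=> v _; exact: abse_ge0.
  - by apply: measurableT_comp => //; exact: measurable_int (i1 w).
  - exact: measurable_int iw.
  - move=> v _; have ga := gauss_gt0 (psub w z) a0; have gb := gauss_gt0 (psub v w) b0.
    rewrite /= lee_fin /H /= normrM (gtr0_norm ga) normrM (gtr0_norm gb) [leRHS]mulrAC.
    by rewrite (ler_pM2r ga) (ler_pM2r gb).
have iG := integZ (M * dint (gauss b)) (integ_gauss_psub z a0).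
have lt_oo : (\int[dA]_w \int[dA]_v `|(EFin \o H) (w, v)| < +oo)%E.
  apply: (@le_lt_trans _ _ (\int[dA]_w (M * dint (gauss b) * gauss a (psub w z))%:E)%E); last first.
    by rewrite (EFin_dint iG) ltry.
  apply: ge0_le_integral.
  - exact: measurableT.
  - by move=> w _; apply: integral_ge0 => v _; exact: abse_ge0.
  - have hA p : (0 <= (abse \o (EFin \o H)) p)%E by exact: abse_ge0.
    have mA : measurable_fun setT (abse \o (EFin \o H)) by exact: measurableT_comp.
    have mF := @measurable_fun_fubini_tonelli_F _ _ _ _ R dA (abse \o (EFin \o H)) mA hA.
    exact: mF.
  - exact: measurable_int iG.
  - by move=> w _; exact: bd.
have [_ iH] := @integrable12ltyP _ _ _ _ R dA dA (EFin \o H) mHE.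
have fub := @Fubini _ _ _ _ R dA dA (EFin \o H) (iH lt_oo).
transitivity (fine (\int[dA]_w \int[dA]_v (EFin \o H) (w, v))%E).
  rewrite /conv {1}/dint /Rintegral; congr fine; apply: eq_integral => w _.
  rewrite [RHS](EFin_dint (i1 w)); congr EFin.
  rewrite mulrC -(dintZ _ (integ_conv w b0)); apply: eq_dint => v.
  by rewrite /H /= mulrC.
rewrite fub {1}/dint /Rintegral; congr fine; apply: eq_integral => v _.
rewrite [LHS](EFin_dint (i2 v)); congr EFin.
rewrite -(dintZ _ (integ_gauss_gauss v z a0 b0)); apply: eq_dint => w.
by rewrite /H /= mulrA.
Qed.

Lemma dint_reflect c (f : pt R -> R) : measurable_fun setT f ->
  dint (fun w => f (psub c w)) = dint f.
Proof.
move=> mf; rewrite /dint /Rintegral; congr fine.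
apply: (@dA_preserving R (psub c) (EFin \o f)).
- exact: measurable_psub.
- exact/measurable_EFinP.
- by move=> h mh h0; exact: ge0_dA_reflect.
Qed.

(** The reflection w -> v + z - w exchanges v - w and w - z. *)
Lemma gauss_gauss_sym a b v z :
  dint (fun w => gauss b (psub v w) * gauss a (psub w z)) =
  dint (fun w => gauss a (psub v w) * gauss b (psub w z)).
Proof.
rewrite -(@dint_reflect (v.1 + z.1, v.2 + z.2)); last first.
  apply: measurable_funM; last exact: measurable_gauss_psub.
  by apply: (measurableT_comp (measurable_gauss b)); exact: measurable_psub.
apply: eq_dint => w; rewrite mulrC.
by congr (gauss a _ * gauss b _); rewrite /psub /=; congr (_, _); ring.
Qed.

Lemma conv_comm a b z : 0 < a -> 0 < b -> conv a (conv b g) z = conv b (conv a g) z.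
Proof.
move=> a0 b0; rewrite (conv_conv z a0 b0) (conv_conv z b0 a0).
by apply: eq_dint => v; congr (_ * _); exact: gauss_gauss_sym.
Qed.

End convolution.

Lemma berezin_comm f a b : Linfty f -> 0 < a -> 0 < b ->
  berezin a 2 (K a) (berezin b 2 (K b) f) = berezin b 2 (K b) (berezin a 2 (K a) f).
Proof.
move=> [f1 [f2 [M fM]]] a0 b0.
rewrite (berezin_conv f b0) (berezin_conv f a0) (berezin_conv _ a0) (berezin_conv _ b0).
apply/funext => z; apply: (f_equal2 (@Complex R)).
  exact: (conv_comm f1 (fun w => le_trans (cRe_le_normc _) (fM w)) z a0 b0).
exact: (conv_comm f2 (fun w => le_trans (cIm_le_normc _) (fM w)) z a0 b0).
Qed.

End gaussian.

Lemma Linfty_fdelta (R : realType) (d m : R) : 0 < d -> Linfty (@fdelta R d m).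
Proof.
move=> d0; split; first exact: (measurable_expw m d).
split; first exact: measurable_cst.
exists 1 => w; rewrite /fdelta normc_real ger0_norm ?expR_ge0 //.
by rewrite -expR0 ler_expR oppr_le0 mulr_ge0 ?powR_ge0 // ltW.
Qed.

Theorem theoremA (R : realType) (m : R) (hm : 0 < m)
  (K : R -> pt R -> pt R -> R[i])
  (hK : forall alpha : R, 0 < alpha -> reproducing_kernel alpha m (K alpha)) :
  [<->
   (* (1) *)
   (forall f : pt R -> R[i], Linfty f ->
      forall alpha beta : R, 0 < alpha -> 0 < beta ->
        berezin alpha m (K alpha) (berezin beta m (K beta) f)
        = berezin beta m (K beta) (berezin alpha m (K alpha) f));
   (* (2) *)
   (forall alpha beta delta : R, 0 < alpha -> 0 < beta -> 0 < delta ->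
        berezin alpha m (K alpha) (berezin beta m (K beta) (fdelta delta m))
        = berezin beta m (K beta) (berezin alpha m (K alpha) (fdelta delta m)));
   (* (3) *)
   (forall alpha beta delta : R, 0 < alpha -> 0 < beta -> 0 < delta ->
        berezin alpha m (K alpha) (berezin beta m (K beta) (fdelta delta m)) (0, 0)
        = berezin beta m (K beta) (berezin alpha m (K alpha) (fdelta delta m)) (0, 0));
   (* (4) *)
   m = 2].
Proof.
split=> [comm a b d a0 b0 d0|]; first exact: (comm _ (Linfty_fdelta m d0)).
split=> [comm a b d a0 b0 d0|]; first by rewrite comm.
split; first exact: (comm0_eq2 hm hK).
move=> m2; rewrite m2 in hK * => f Lf a b a0 b0; exact: (berezin_comm hK Lf a0 b0).
Qed.
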